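(* Let $\xi \in L^2(\Omega,\mathcal F_T,\mathbb P;\mathbb R)$. There exists a unique decomposition of the form $$\xi = U_0 + \int_0^T H_t^{\mathcal H}\,\mathrm dM_t + O_T,\quad \mathbb P\text{-a.s.},$$ where $U_0$ is $\mathcal H_0$-measurable, $H^{\mathcal H}=(H^{\mathcal H}_t)_{0\le t\le T}$ is an $\mathbb H$-predictable process such that $\mathbb E\big[\int_0^T|H_t^{\mathcal H}|^2\,\mathrm d\langle M\rangle_t\big]<\infty$, and $O=(O_t)_{0\le t\le T}$ is a square-integrable $\mathbb F$-martingale with $O_0=0$ such that $\mathbb E[O_T\cdot\eta]=0$ for every $\eta\in\mathcal L_T^{\mathcal H}$. Moreover $U_0=\mathbb E[\xi\mid\mathcal H_0]$ and $\mathbb E[O_T\mid\mathcal H_0]=0$.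
   Context: Fix $T>0$ and a probability space $(\Omega,\mathcal F,\mathbb P)$ with a filtration $\mathbb F=(\mathcal F_t)_{0\le t\le T}$, $\mathcal F_T=\mathcal F$, and a subfiltration $\mathbb H=(\mathcal H_t)_{0\le t\le T}$ of $\mathbb F$, i.e. $\mathcal H_t\subseteq\mathcal F_t$ for each $t\in[0,T]$. Both filtrations satisfy the usual hypotheses of completeness and right-continuity. $M=(M_t)_{0\le t\le T}$ is a real-valued square-integrable càdlàg $\mathbb F$-martingale with $\mathbb F$-predictable quadratic variation $\langle M\rangle$. $L^2(\Omega,\mathcal F_T,\mathbb P;\mathbb R)$ is the space of real $\mathcal F_T$-measurable random variables with finite second moment. $\mathcal L_T^{\mathcal H}$ denotes the linear subspace of $L^2(\Omega,\mathcal F_T,\mathbb P;\mathbb R)$ of all random variables of the form $U_0+\int_0^T\varphi_t\,\mathrm dM_t$, where $U_0$ is $\mathcal H_0$-measurable and $\varphi$ is $\mathbb H$-predictable with $\mathbb E[\int_0^T|\varphi_t|^2\,\mathrm d\langle M\rangle_t]<\infty$. Uniqueness is understood with random variables identified when $\mathbb P$-a.s. equal, martingales when indistinguishable, and integrands when equal $\mathrm d\langle M\rangle\otimes\mathrm d\mathbb P$-a.e.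
   Formalization: The requirement O_0=0 is false in general (M=0, H_0 trivial, ξ nonconstant and F_0-measurable); it is dropped from the decomposition and replaced by: O_0=0 a.s. if and only if U_0=E[ξ|H_0] is also a version of E[ξ|F_0]. O is taken càdlàg. *)

(* Defs.v *)
From HB Require Import structures.
From mathcomp Require Import all_boot all_order all_algebra.
From mathcomp Require Import all_classical all_reals all_analysis.

Set Implicit Arguments.
Unset Strict Implicit.
Unset Printing Implicit Defensive.

Import Order.TTheory GRing.Theory Num.Theory.
Import numFieldNormedType.Exports.

Local Open Scope classical_set_scope.
Local Open Scope ring_scope.

(* The time index of filtrations and processes is the whole of R, but only
   their values on [0, T] are ever constrained or used.
   The standing convention is \int_0^T = \int_(]0, T]), so that the values at
   time 0 of integrands play no role. *)

Section filtrations.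
Context {R : realType} {d : measure_display} {Omega : measurableType d}.
Implicit Types (P : probability Omega R) (T : R) (G : set (set Omega)).
Implicit Types (F : R -> set (set Omega)) (X : R -> Omega -> R).

Definition filtration T F : Prop :=
  (forall t, 0 <= t <= T ->
     sigma_algebra setT (F t) /\ F t `<=` @measurable d Omega) /\
  (forall s t, 0 <= s -> s <= t -> t <= T -> F s `<=` F t).

Definition complete_filtration P T F : Prop :=
  forall t N, 0 <= t <= T -> P.-negligible N -> F t N.

Definition right_continuous_filtration T F : Prop :=
  forall t, 0 <= t < T -> \bigcap_(s in `]t, T]) F s = F t.

Definition usual_hypotheses P T F : Prop :=
  complete_filtration P T F /\ right_continuous_filtration T F.

Definition measurable_wrt G (Y : Omega -> R) : Prop :=
  forall B : set R, measurable B -> G (Y @^-1` B).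

(* Y is a version of the conditional expectation of X given G *)
Definition is_cond_exp P G (X Y : Omega -> R) : Prop :=
  [/\ measurable_wrt G Y,
      P.-integrable setT (EFin \o Y) &
      forall B, G B ->
        (\int[P]_(w in B) (Y w)%:E = \int[P]_(w in B) (X w)%:E)%E].

(* generators of the predictable sigma-algebra on [0, T] x Omega *)
Definition predictable_rectangles T F : set (set (R * Omega)) :=
  [set C | (exists2 B, F 0 B & C = [set 0] `*` B) \/
           (exists s t B, [/\ 0 <= s, s < t, t <= T, F s B &
                              C = `]s, t] `*` B])].

Definition predictable T F X : Prop :=
  let D := `[0, T] `*` [set: Omega] in
  forall B : set R, measurable B ->
    <<s D, predictable_rectangles T F >> (D `&` [set x | B (X x.1 x.2)]).

Definition martingale P T F X : Prop :=
  [/\ forall t, 0 <= t <= T -> measurable_wrt (F t) (X t),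
      forall t, 0 <= t <= T -> P.-integrable setT (EFin \o X t) &
      forall s t, 0 <= s -> s <= t -> t <= T ->
        is_cond_exp P (F s) (X t) (X s)].

Definition cadlag T X : Prop :=
  forall w,
    (forall t, 0 <= t < T -> X s w @[s --> t^'+] --> X t w) /\
    (forall t, 0 < t <= T -> cvg (X s w @[s --> t^'-])).

Definition square_integrable_martingale P T F X : Prop :=
  [/\ martingale P T F X, cadlag T X &
      forall t, 0 <= t <= T -> X t \in Lfun P 2%:E].

Definition indistinguishable P T X Y : Prop :=
  {ae P, forall w, forall t, 0 <= t <= T -> X t w = Y t w}.

End filtrations.

Section stochastic_integral.
Context {R : realType} {d : measure_display} {Omega : measurableType d}.
Implicit Types (P : probability Omega R) (T : R).
Implicit Types (F H : R -> set (set Omega)) (M phi psi : R -> Omega -> R).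
(* The paths of the predictable quadratic variation are taken extended from
   [0, T] to nondecreasing right-continuous functions on R; the choice of the
   extension is irrelevant since they are only integrated on ]0, T]. *)
Implicit Types (QV : Omega -> cumulative R R).

(* QV = <M>: the predictable increasing process null at 0 such that M^2 - QV
   is a martingale *)
Definition predictable_quadratic_variation P T F M QV : Prop :=
  [/\ predictable T F (fun t w => QV w t),
      forall w, QV w 0 = 0 &
      martingale P T F (fun t w => M t w ^+ 2 - QV w t)].

(* E [ \int_0^T |phi_t|^2 d<M>_t ] *)
Definition dMdP_sqnorm P T QV phi : \bar R :=
  (\int[P]_w \int[lebesgue_stieltjes_measure (QV w)]_(t in `]0%R, T])
      (phi t w ^+ 2)%:E)%E.

(* equality almost everywhere with respect to d<M> (x) dP on ]0, T] x Omega *)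
Definition dMdP_ae_eq P T QV phi psi : Prop :=
  (\int[P]_w lebesgue_stieltjes_measure (QV w)
      [set t | 0 < t <= T /\ phi t w <> psi t w]%R = 0)%E.

(* simple predictable integrands \sum_i Z_i 1_(]s_i, t_i]) with Z_i bounded and
   F_(s_i)-measurable *)
Record simple_integrand T F := SimpleIntegrand {
  si_size : nat ;
  si_left : 'I_si_size -> R ;
  si_right : 'I_si_size -> R ;
  si_coef : 'I_si_size -> Omega -> R ;
  si_itv : forall i,
    [/\ 0 <= si_left i, si_left i <= si_right i & si_right i <= T] ;
  si_meas : forall i, measurable_wrt (F (si_left i)) (si_coef i) ;
  si_bounded : forall i, exists C : R, forall w, `|si_coef i w| <= C
}.

Definition si_process T F (e : simple_integrand T F) (t : R) (w : Omega) : R :=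
  \sum_(i < si_size e)
     si_coef i w * \1_(`]si_left i, si_right i] : set R) t.

Definition si_integral T F M (e : simple_integrand T F) (w : Omega) : R :=
  \sum_(i < si_size e) si_coef i w * (M (si_right i) w - M (si_left i) w).

(* I is a version of the Ito integral \int_0^T phi_t dM_t: the L^2(P)-limit of
   the integrals of simple integrands converging to phi in
   L^2(d<M> (x) dP).  By the Ito isometry, I is unique up to a.s. equality. *)
Definition is_stochastic_integral P T F M QV phi (I : Omega -> R) : Prop :=
  I \in Lfun P 2%:E /\
  exists e : nat -> simple_integrand T F,
    (dMdP_sqnorm P T QV (fun t w => si_process (e n) t w - phi t w)
       @[n --> \oo] --> 0%E) /\
    ('E_P[fun w => ((si_integral M (e n) w - I w) ^+ 2)%R]%E
       @[n --> \oo] --> 0%E).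

Definition admissible_integrand P T H QV phi : Prop :=
  predictable T H phi /\ (dMdP_sqnorm P T QV phi < +oo)%E.

(* the subspace L_T^H of L^2(P) *)
Definition integral_space P T F H M QV : set (Omega -> R) :=
  [set eta | eta \in Lfun P 2%:E /\
    exists U phi I,
      [/\ measurable_wrt (H 0) U,
          admissible_integrand P T H QV phi,
          is_stochastic_integral P T F M QV phi I &
          {ae P, forall w, eta w = U w + I w}]].

(* The decomposition xi = U + \int_0^T phi_t dM_t + O_T.
   O 0 = 0 is not required: taking E[. | F_0] shows that it holds if and only
   if E[xi | F_0] = E[xi | H_0], which may fail when H_0 is smaller than F_0
   (e.g. M = 0, H_0 trivial, xi non-constant and F_0-measurable). *)
Definition decomposition P T F H M QV (xi U : Omega -> R) phi
    (O : R -> Omega -> R) : Prop :=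
  [/\ measurable_wrt (H 0) U,
      admissible_integrand P T H QV phi,
      square_integrable_martingale P T F O,
      exists2 I, is_stochastic_integral P T F M QV phi I &
        {ae P, forall w, xi w = U w + I w + O T w} &
      forall eta, integral_space P T F H M QV eta ->
        ('E_P[(O T \* eta)%R] = 0)%E].

End stochastic_integral.

(* Main.v *)
Require Import Defs.
From HB Require Import structures.
From mathcomp Require Import all_boot all_order all_algebra.
From mathcomp Require Import all_classical all_reals all_analysis.
From mathcomp Require Import measurable_realfun ring lra.

Import Order.TTheory GRing.Theory Num.Theory.
Import numFieldNormedType.Exports.

Local Open Scope classical_set_scope.
Local Open Scope ring_scope.

Set Implicit Arguments.
Unset Strict Implicit.
Unset Printing Implicit Defensive.

(** The space [integral_space] is a closed subspace of L^2(P): in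
    [eta = U + \int phi dM] the two summands are orthogonal, and by Ito's
    isometry the second one has the norm of [phi] in L^2 of the measure
    [d<M> (x) dP] on the predictable sigma-algebra; so a Cauchy sequence of such
    [eta] yields Cauchy sequences of [U]'s and of [phi]'s, and both L^2 spaces
    are complete.  Only integrands that come with an integral enter, so that
    density of simple integrands is not needed.  The decomposition is the
    orthogonal projection of [xi], and [O_T] is the residual.

    The process [O] has to be a cadlag version of [E[O_T | F_t]].  For a
    square-integrable martingale the regularization does not need upcrossings:
    let [A] be the value of the path at its last move by more than [e].  On a
    finite grid, [e^2 (number of moves) <= x_n^2 - 2 \sum_i A_i (x_(i+1) - x_i)],
    and the sum has expectation 0, so the expected number of moves is bounded
    uniformly in the grid.  The liminf of these numbers along the dyadic grids
    is almost surely a finite nondecreasing function of time that increases by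
    at least 1 whenever the path oscillates by more than [2 e]; hence one-sided
    limits exist. *)

(** * L^2 spaces *)

(** The obstacle is to keep measurability in the limit. The integrands converge in L^2 of a measure
    on the F-predictable sets, but their limit must be H-predictable, just as the limit of the [U]'s
    must be H_0-measurable. Completeness of L^2 is therefore proved with an explicit limit, the
    limsup of a subsequence, which inherits measurability for every sub-sigma-algebra shared by the
    sequence. Pythagoras in [ip_dist_integral_space] serves twice. It gives closedness, and it gives
    uniqueness: the difference of two projections of [xi] lies in the space and is orthogonal to
    itself, so both of its summands vanish. Stochastic integrals are orthogonal to all of L^2(F_0),
    not only to L^2(H_0). Hence E[O_T | F_0] = E[xi | F_0] - U, and O_0 = 0 a.s. exactly when U is a
    version of E[xi | F_0]. For the version of O, completeness of F allows the paths to be set to 0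
    on a null set that depends on the whole of [0, T]; right-continuity of F makes a limit from the
    right adapted. *)

Section L2.
Context d (T : measurableType d) (R : realType).
Variable mu : {measure set T -> \bar R}.
Implicit Types f g h : T -> R.

Local Notation L2 := (Lfun mu 2%:E).

(** Real-valued through [fine], which suits linear arithmetic; it represents the integral faithfully
    as soon as both arguments are in L^2, whence the membership hypotheses below. *)
Definition ip f g : R := \int[mu]_x (f x * g x).

Lemma Lfun2P f : measurable_fun setT f ->
  (\int[mu]_x (f x ^+ 2)%:E < +oo)%E -> f \in L2.
Proof.
move=> mf ff; rewrite inE; apply/andP; split; rewrite inE//=.
rewrite /finite_norm unlock poweR_lty//=.
by under eq_integral do rewrite powR_mulrn// real_normK ?num_real//.
Qed.

Lemma Lfun2_measurable f : f \in L2 -> measurable_fun setT f.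
Proof. by rewrite inE => /andP[] /[!inE]. Qed.

Lemma Lfun2D f g : f \in L2 -> g \in L2 -> (fun x => f x + g x) \in L2.
Proof. by move=> fL gL; case: (Lfun_addr_closed mu (lee1n 2)) => _; exact. Qed.

Lemma Lfun2Z a f : f \in L2 -> (fun x => a * f x) \in L2.
Proof.
move=> fL; have := @Lfun_scale _ _ _ mu f a 2; rewrite (_ : a \o* f = fun x => a * f x).
  by apply => //; rewrite ler1n.
by apply/funext => x /=; rewrite mulrC.
Qed.

Lemma Lfun2N f : f \in L2 -> (fun x => - f x) \in L2.
Proof. by move=> /(Lfun2Z (-1)); under eq_fun do rewrite mulN1r. Qed.

Lemma Lfun2B f g : f \in L2 -> g \in L2 -> (fun x => f x - g x) \in L2.
Proof. by move=> fL /Lfun2N gL; exact: Lfun2D. Qed.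

Lemma Lfun2_sum n (f : 'I_n -> T -> R) : (forall i, f i \in L2) ->
  (fun x => \sum_i f i x) \in L2.
Proof.
elim: n f => [|n IH] f fL.
  under eq_fun do rewrite big_ord0.
  apply: Lfun2P => //; under eq_integral do rewrite expr0n/=.
  by rewrite integral0 ltry.
under eq_fun do rewrite big_ord_recl.
by apply: Lfun2D; [exact: fL|exact: IH].
Qed.

Lemma Lfun2M_integrable f g : f \in L2 -> g \in L2 ->
  mu.-integrable setT (EFin \o (fun x => f x * g x)).
Proof. by move=> fL gL; apply/Lfun1_integrable; exact: Lfun2_mul_Lfun1. Qed.

Lemma ipE f g : f \in L2 -> g \in L2 ->
  (\int[mu]_x (f x * g x)%:E = (ip f g)%:E)%E.
Proof. by move=> fL gL; rewrite fineK// integrable_fin_num// Lfun2M_integrable. Qed.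

Lemma ip_sqE f : f \in L2 -> (\int[mu]_x (f x ^+ 2)%:E = (ip f f)%:E)%E.
Proof. by move=> fL; rewrite -ipE//; under eq_integral do rewrite expr2. Qed.

Lemma ipC f g : ip f g = ip g f.
Proof. by apply: eq_Rintegral => x _; rewrite mulrC. Qed.

Lemma ip_ge0 f : 0 <= ip f f.
Proof. by apply: Rintegral_ge0 => x _; rewrite -expr2 sqr_ge0. Qed.

Lemma ipDl f g h : f \in L2 -> g \in L2 -> h \in L2 ->
  ip (fun x => f x + g x) h = ip f h + ip g h.
Proof.
move=> fL gL hL; rewrite /ip -RintegralD//; [|exact: Lfun2M_integrable..].
by apply: eq_Rintegral => x _; rewrite mulrDl.
Qed.

Lemma ipZl a f g : f \in L2 -> g \in L2 -> ip (fun x => a * f x) g = a * ip f g.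
Proof.
move=> fL gL; rewrite /ip -RintegralZl//; last exact: Lfun2M_integrable.
by apply: eq_Rintegral => x _; rewrite mulrA.
Qed.

Lemma ipNl f g : f \in L2 -> g \in L2 -> ip (fun x => - f x) g = - ip f g.
Proof.
move=> fL gL; rewrite -mulN1r -ipZl//.
by apply: eq_Rintegral => x _; rewrite mulN1r.
Qed.

Lemma ipBl f g h : f \in L2 -> g \in L2 -> h \in L2 ->
  ip (fun x => f x - g x) h = ip f h - ip g h.
Proof. by move=> fL gL hL; rewrite (ipDl fL (Lfun2N gL) hL) ipNl. Qed.

Lemma ipDr f g h : f \in L2 -> g \in L2 -> h \in L2 ->
  ip h (fun x => f x + g x) = ip h f + ip h g.
Proof. by move=> fL gL hL; rewrite ipC ipDl// !(ipC h). Qed.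

Lemma ipZr a f g : f \in L2 -> g \in L2 -> ip g (fun x => a * f x) = a * ip g f.
Proof. by move=> fL gL; rewrite ipC ipZl// ipC. Qed.

Lemma ipBr f g h : f \in L2 -> g \in L2 -> h \in L2 ->
  ip h (fun x => f x - g x) = ip h f - ip h g.
Proof. by move=> fL gL hL; rewrite ipC ipBl// !(ipC h). Qed.

Lemma ip_suml n (f : 'I_n -> T -> R) g : (forall i, f i \in L2) -> g \in L2 ->
  ip (fun x => \sum_i f i x) g = \sum_i ip (f i) g.
Proof.
move=> fL gL; elim: n f fL => [|n IH] f fL.
  rewrite big_ord0 /ip -[RHS](mul0r (fine (mu setT))) -Rintegral_cst//.
  by apply: eq_Rintegral => x _; rewrite big_ord0 mul0r.
rewrite big_ord_recl -IH; last by move=> i; exact: fL.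
rewrite -ipDl//; last exact: Lfun2_sum.
by apply: eq_Rintegral => x _; rewrite big_ord_recl.
Qed.

Lemma eq_ip f1 f2 g1 g2 : f1 =1 f2 -> g1 =1 g2 -> ip f1 g1 = ip f2 g2.
Proof. by move=> /funext -> /funext ->. Qed.

Lemma ipDsq f g : f \in L2 -> g \in L2 ->
  ip (fun x => f x + g x) (fun x => f x + g x) = ip f f + 2 * ip f g + ip g g.
Proof.
by move=> fL gL; rewrite !(ipDl, ipDr)//; [rewrite (ipC g f); ring|exact: Lfun2D].
Qed.

Lemma ipBsq f g : f \in L2 -> g \in L2 ->
  ip (fun x => f x - g x) (fun x => f x - g x) = ip f f - 2 * ip f g + ip g g.
Proof.
by move=> fL gL; rewrite !(ipBl, ipBr)//; [rewrite (ipC g f); ring|exact: Lfun2B].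
Qed.

Lemma ip_CauchySchwarz f g : f \in L2 -> g \in L2 ->
  ip f g ^+ 2 <= ip f f * ip g g.
Proof.
move=> fL gL.
have H a b : 0 <= a ^+ 2 * ip f f - 2 * (a * b) * ip f g + b ^+ 2 * ip g g.
  have := ip_ge0 (fun x => a * f x - b * g x).
  rewrite ipBsq ?Lfun2Z// !(ipZl, ipZr) ?Lfun2Z//.
  by congr (_ <= _); ring.
have [g0|g0] := eqVneq (ip g g) 0.
  rewrite g0 mulr0.
  have [->|fg0] := eqVneq (ip f g) 0; first by rewrite expr0n.
  (* When [ip g g = 0] the form is affine in the second coefficient; this value makes it equal to
     -1, a contradiction. *)
  have := H 1 ((1 + ip f f) / (2 * ip f g)).
  rewrite g0 mulr0 addr0 expr1n !mul1r.
  rewrite (_ : 2 * _ * _ = 1 + ip f f); last by field.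
  lra.
have gp : 0 < ip g g by rewrite lt_def g0 ip_ge0.
(* These are the coefficients of the residual of f along g, scaled by [ip g g] to avoid a
   division. *)
have := H (ip g g) (ip f g).
rewrite (_ : _ + _ = ip g g * (ip f f * ip g g - ip f g ^+ 2)); last by ring.
by rewrite pmulr_rge0// subr_ge0.
Qed.

Lemma ip_sq_ae0 f : f \in L2 -> ip f f = 0 -> {ae mu, forall x, f x = 0}.
Proof.
move=> fL f0; have mf := Lfun2_measurable fL.
have := ip_sqE fL; rewrite f0.
under eq_integral do rewrite -[(f _ ^+ 2)%:E]gee0_abs ?lee_fin ?sqr_ge0//.
move=> /(ae_eq_integral_abs mu measurableT) => h.
have /h : measurable_fun setT ((fun x => (f x ^+ 2)%:E) : T -> \bar R).
  by apply/measurable_EFinP; exact: measurable_funX.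
apply: filterS => x /(_ I)/= [] /eqP; rewrite sqrf_eq0 => /eqP//.
Qed.

Lemma ae_eq_ip f1 f2 g : f1 \in L2 -> f2 \in L2 -> g \in L2 ->
  {ae mu, forall x, f1 x = f2 x} -> ip f1 g = ip f2 g.
Proof.
move=> f1L f2L gL f12; congr fine; apply: ae_eq_integral => //.
- exact: (measurable_int mu (Lfun2M_integrable f1L gL)).
- exact: (measurable_int mu (Lfun2M_integrable f2L gL)).
- by apply: filterS f12 => x /= -> _.
Qed.

Lemma ae_eq_Lfun2 f g : measurable_fun setT g -> f \in L2 ->
  {ae mu, forall x, f x = g x} -> g \in L2.
Proof.
move=> mg fL fg; apply: Lfun2P => //.
have := ip_sqE fL; have mf := Lfun2_measurable fL => h.
rewrite [ltLHS](_ : _ = (ip f f)%:E) ?ltry// -h; apply: ae_eq_integral => //.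
- by apply/measurable_EFinP; exact: measurable_funX.
- by apply/measurable_EFinP; exact: measurable_funX.
- by apply: filterS fg => x /= -> _.
Qed.

(** The triangle inequality for squared norms: the factor 2, from the parallelogram law, is the
    price for keeping square roots out of all later estimates. *)
Lemma ipD_le f g : f \in L2 -> g \in L2 ->
  ip (fun x => f x + g x) (fun x => f x + g x) <= 2 * ip f f + 2 * ip g g.
Proof.
move=> fL gL; have := ip_ge0 (fun x => f x - g x).
by rewrite ipBsq// ipDsq//; lra.
Qed.

Lemma ip_triangle f g h : f \in L2 -> g \in L2 -> h \in L2 ->
  ip (fun x => f x - h x) (fun x => f x - h x) <=
  2 * ip (fun x => f x - g x) (fun x => f x - g x) +
  2 * ip (fun x => g x - h x) (fun x => g x - h x).
Proof.
move=> fL gL hL.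
rewrite (_ : (fun x => f x - h x) = fun x => (f x - g x) + (g x - h x)).
  by apply: ipD_le; exact: Lfun2B.
by apply/funext => x; rewrite addrA subrK.
Qed.

Lemma ip_distC f g : ip (fun x => f x - g x) (fun x => f x - g x) =
  ip (fun x => g x - f x) (fun x => g x - f x).
Proof. by apply: eq_Rintegral => x _; ring. Qed.

Lemma cvg_ipl (f_ : nat -> T -> R) f g : (forall n, f_ n \in L2) -> f \in L2 ->
  g \in L2 -> ip (fun x => f_ n x - f x) (fun x => f_ n x - f x) @[n --> \oo] --> 0 ->
  ip (f_ n) g @[n --> \oo] --> ip f g.
Proof.
move=> f_L fL gL h; apply/cvgrPdist_lt => e e0.
have gg : 0 <= ip g g := ip_ge0 g.
(* The tolerance dictated by Cauchy-Schwarz, with [1 + ip g g] in the denominator to cover g = 0. *)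
have e2 : 0 < e ^+ 2 / (1 + ip g g) by rewrite divr_gt0 ?exprn_gt0//; lra.
move/cvgrPdist_lt : h => /(_ _ e2); apply: filterS => n.
rewrite sub0r normrN ger0_norm ?ip_ge0// ltr_pdivlMr; last lra.
move=> nh; rewrite distrC -ipBl//.
have := ip_CauchySchwarz (Lfun2B (f_L n) fL) gL.
set u := ip _ _ in nh *; set v := ip _ g => uv.
rewrite -(@ltr_pXn2r _ 2)// ?nnegrE// ?ltW//.
rewrite real_normK ?num_real//; apply: le_lt_trans uv _.
have := ip_ge0 (fun x => f_ n x - f x); rewrite -/u; nra.
Qed.

Lemma cvg_ip_sq (f_ : nat -> T -> R) f : (forall n, f_ n \in L2) -> f \in L2 ->
  ip (fun x => f_ n x - f x) (fun x => f_ n x - f x) @[n --> \oo] --> 0 ->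
  ip (f_ n) (f_ n) @[n --> \oo] --> ip f f.
Proof.
move=> f_L fL h.
have -> : (fun n => ip (f_ n) (f_ n)) =
    (fun n => ip (fun x => f_ n x - f x) (fun x => f_ n x - f x)
       + 2 * ip (f_ n) f - ip f f).
  by apply/funext => n; rewrite ipBsq//; ring.
rewrite [X in _ --> X](_ : _ = 0 + 2 * ip f f - ip f f); last by ring.
apply: cvgB; last exact: cvg_cst.
apply: cvgD => //; apply: cvgMl_tmp.
exact: cvg_ipl.
Qed.

Lemma cvg_ip_harmonic (f_ : nat -> T -> R) f :
  (forall n, ip (fun x => f_ n x - f x) (fun x => f_ n x - f x) < n.+1%:R^-1) ->
  ip (fun x => f_ n x - f x) (fun x => f_ n x - f x) @[n --> \oo] --> 0.
Proof.
move=> h; apply: (@squeeze_cvgr _ _ _ _ (cst 0) harmonic).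
- by apply: nearW => n; rewrite /= ip_ge0 ltW// h.
- exact: cvg_cst.
- exact: cvg_harmonic.
Qed.

End L2.

(** * Lower limits, and pointwise limits that stay measurable *)

Lemma le_limn_einf_near (R : realType) (u v : (\bar R)^nat) :
  (\forall n \near \oo, (u n <= v n)%E) -> (limn_einf u <= limn_einf v)%E.
Proof.
case=> N _ uv; rewrite !limn_einf_lim.
apply: lee_lim; [exact: is_cvg_einfs..|].
exists N => // n /= Nn; apply: le_ereal_inf_tmp => _ [m /= nm <-].
apply: (@le_trans _ _ (u m)); last by apply: uv => /=; exact: leq_trans nm.
by apply: ereal_inf_lbound; exists m.
Qed.

Lemma limn_einf_cst (R : realType) (e : \bar R) : limn_einf (fun=> e) = e.
Proof. by rewrite (cvg_limn_einf_sup (cvg_cst e)).1. Qed.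

Lemma measurable_fun_limn_einf (R : realType) d (T : measurableType d)
    (f_ : (T -> \bar R)^nat) : (forall n, measurable_fun setT (f_ n)) ->
  measurable_fun setT (fun x => limn_einf (f_ ^~ x)).
Proof.
move=> mf; apply: measurableT_comp => //.
by apply: measurable_fun_limn_esup => n; exact: measurableT_comp.
Qed.

(* [limn_esup] makes this measurable whether or not the sequence converges *)
Definition limfun (R : realType) T (f_ : nat -> T -> R) (x : T) : R :=
  fine (limn_esup (fun n => (f_ n x)%:E)).

Lemma cvg_limfun (R : realType) T (f_ : nat -> T -> R) x :
  cvgn (f_ ^~ x) -> f_ n x @[n --> \oo] --> limfun f_ x.
Proof.
move=> cf; rewrite /limfun.
have h : (f_ n x)%:E @[n --> \oo] --> (limn (f_ ^~ x))%:E by apply: cvg_EFin => //; exact: nearW.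
by rewrite (cvg_limn_einf_sup h).2.
Qed.

Lemma measurable_limfun (R : realType) d (T : measurableType d)
    (f_ : nat -> T -> R) :
  (forall n, measurable_fun setT (f_ n)) -> measurable_fun setT (limfun f_).
Proof.
move=> mf; apply: measurableT_comp => //.
by apply: measurable_fun_limn_esup => n; exact/measurable_EFinP.
Qed.

(** * Measurability with respect to a sub-sigma-algebra *)

Section measurable_wrt.
Context (R : realType) d (T : measurableType d).
Variable G : set (set T).
Hypothesis sG : sigma_algebra setT G.

(** As G is already a sigma-algebra, generating from it adds no set; every closure property of
    measurable functions can then be used for [measurable_wrt]. *)
Lemma measurable_wrtP (f : T -> R) :
  measurable_wrt G f <-> measurable_fun [set: g_sigma_algebraType G] f.
Proof.
have E := measurable_g_measurableTypeE sG.
split=> [mf _ B mB|mf B mB]; last first.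
  by rewrite -E -[X in _ X]setTI; exact: mf.
by rewrite setTI; have := mf B mB; rewrite -{1}E.
Qed.

Lemma measurable_wrt_limfun (f_ : nat -> T -> R) :
  (forall n, measurable_wrt G (f_ n)) -> measurable_wrt G (limfun f_).
Proof.
move=> mf; apply/measurable_wrtP.
by apply: (@measurable_limfun R _ (g_sigma_algebraType G)) => n; exact/measurable_wrtP.
Qed.

Lemma measurable_wrt_cst (c : R) : measurable_wrt G (cst c).
Proof. by apply/measurable_wrtP; exact: measurable_cst. Qed.

Lemma measurable_wrtD (f g : T -> R) : measurable_wrt G f -> measurable_wrt G g ->
  measurable_wrt G (fun x => f x + g x).
Proof.
move=> /measurable_wrtP mf /measurable_wrtP mg; apply/measurable_wrtP.
exact: measurable_funD.
Qed.

Lemma measurable_wrtM (f g : T -> R) : measurable_wrt G f -> measurable_wrt G g ->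
  measurable_wrt G (fun x => f x * g x).
Proof.
move=> /measurable_wrtP mf /measurable_wrtP mg; apply/measurable_wrtP.
exact: measurable_funM.
Qed.

Lemma measurable_wrtZ (c : R) (f : T -> R) : measurable_wrt G f ->
  measurable_wrt G (fun x => c * f x).
Proof. by apply: measurable_wrtM; exact: measurable_wrt_cst. Qed.

Lemma measurable_wrtB (f g : T -> R) : measurable_wrt G f -> measurable_wrt G g ->
  measurable_wrt G (fun x => f x - g x).
Proof.
move=> /measurable_wrtP mf /measurable_wrtP mg; apply/measurable_wrtP.
exact: measurable_funB.
Qed.

Lemma measurable_wrt_sum n (f : 'I_n -> T -> R) :
  (forall i, measurable_wrt G (f i)) -> measurable_wrt G (fun x => \sum_i f i x).
Proof.
move=> mf; apply/measurable_wrtP.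
by apply: (@measurable_sum _ (g_sigma_algebraType G)) => i; exact/measurable_wrtP.
Qed.

Lemma measurable_wrt_indic (B : set T) : G B -> measurable_wrt G (\1_B : T -> R).
Proof.
move=> GB; apply/measurable_wrtP.
apply: (@measurable_indic _ (g_sigma_algebraType G)).
by rewrite measurable_g_measurableTypeE.
Qed.

End measurable_wrt.

Lemma measurable_wrt_measurable (R : realType) d (T : measurableType d)
    (G : set (set T)) (f : T -> R) : G `<=` measurable ->
  measurable_wrt G f -> measurable_fun setT f.
Proof. by move=> Gm mf _ B mB; rewrite setTI; exact/Gm/mf. Qed.

Lemma measurable_wrtS (R : realType) d (T : measurableType d)
    (G G' : set (set T)) (f : T -> R) : G `<=` G' ->
  measurable_wrt G f -> measurable_wrt G' f.
Proof. by move=> GG' mf B mB; exact/GG'/mf. Qed.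

(** * Completeness of L^2 *)

Section completeness.
Context d (T : measurableType d) (R : realType).
Variable mu : {measure set T -> \bar R}.
Implicit Types (f g h : T -> R).
Local Notation L2 := (Lfun mu 2%:E).

Definition Lfun2_cauchy (f_ : nat -> T -> R) := forall e : R, 0 < e -> exists N, forall m n,
  (N <= m)%N -> (N <= n)%N ->
  ip mu (fun x => f_ m x - f_ n x) (fun x => f_ m x - f_ n x) < e.

(* By Fatou, |f_n - f|^2 <= liminf_m |f_n - f_m|^2. *)
Lemma Lfun2_cauchy_ae_cvg (f_ : nat -> T -> R) f : (forall n, f_ n \in L2) -> Lfun2_cauchy f_ ->
  measurable_fun setT f -> {ae mu, forall x, f_ n x @[n --> \oo] --> f x} ->
  f \in L2 /\
  ip mu (fun x => f_ n x - f x) (fun x => f_ n x - f x) @[n --> \oo] --> 0.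
Proof.
move=> fL fC mf f_f; have mf_ n := Lfun2_measurable (fL n).
have H e : 0 < e -> exists N, forall n, (N <= n)%N ->
    (\int[mu]_x ((f_ n x - f x) ^+ 2)%:E <= e%:E)%E.
  move=> /fC[N HN]; exists N => n Nn.
  have mn m : measurable_fun setT (fun x => ((f_ n x - f_ m x) ^+ 2)%:E : \bar R).
    by apply/measurable_EFinP; apply: measurable_funX; exact: measurable_funB.
  apply: (@le_trans _ _ (\int[mu]_x
      limn_einf (fun m => ((f_ n x - f_ m x) ^+ 2)%:E))%E).
    apply: ae_ge0_le_integral => //.
    - by move=> x _; rewrite lee_fin sqr_ge0.
    - by apply/measurable_EFinP; apply: measurable_funX; exact: measurable_funB.
    - move=> x _; rewrite -[leLHS]limn_einf_cst; apply: le_limn_einf_near.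
      by apply: nearW => m; rewrite lee_fin sqr_ge0.
    - exact: measurable_fun_limn_einf.
    - apply: filterS f_f => x fx _.
      have := @cvg_limn_einf_sup R (fun m => ((f_ n x - f_ m x) ^+ 2)%:E) ((f_ n x - f x) ^+ 2)%:E.
      case; last by move=> -> _.
      apply: cvg_EFin; first exact: nearW.
      apply: (@cvg_comp _ _ _ _ (fun x => x ^+ 2) _ (nbhs (f_ n x - f x))).
        by apply: cvgB => //; exact: cvg_cst.
      exact: exprn_continuous.
  apply: (le_trans (fatou mu measurableT mn _)).
    by move=> m x _; rewrite lee_fin sqr_ge0.
  rewrite -[leRHS]limn_einf_cst; apply: le_limn_einf_near; exists N => // m /= Nm.
  by rewrite ip_sqE ?lee_fin ?ltW ?HN//; exact: Lfun2B.
have fL2 : f \in L2.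
  have [N HN] := H _ ltr01.
  have : (fun x => f_ N x - f x) \in L2.
    apply: Lfun2P; first by apply: measurable_funB.
    by apply: (le_lt_trans (HN N (leqnn N))); rewrite ltry.
  move=> /(Lfun2B (fL N)); by under eq_fun do rewrite subKr.
split=> //; apply/cvgrPdist_le => e /H[N HN]; exists N => // n /= Nn.
rewrite sub0r normrN ger0_norm ?ip_ge0// -lee_fin -ip_sqE ?HN//.
exact: Lfun2B.
Qed.

(** The limit is exhibited as [limfun] of a subsequence so that it inherits measurability with
    respect to any sub-sigma-algebra for which all [f_ n] are measurable. *)
Lemma Lfun2_complete (f_ : nat -> T -> R) : (forall n, f_ n \in L2) -> Lfun2_cauchy f_ ->
  exists s : nat -> nat, let f := limfun (fun k => f_ (s k)) in f \in L2 /\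
  ip mu (fun x => f_ n x - f x) (fun x => f_ n x - f x) @[n --> \oo] --> 0.
Proof.
move=> fL fC.
have e8 k : 0 < 8^-1 ^+ k :> R by rewrite exprn_gt0.
have [N HN] := choice (fun k => fC _ (e8 k)).
pose s k := (\sum_(j < k.+1) N j)%N.
have sN k j : (k <= j)%N -> (N k <= s j)%N.
  by move=> kj; rewrite /s (bigD1 (Ordinal (kj : (k < j.+1)%N)))//= leq_addr.
exists s; set g := fun k => f_ (s k).
have gL k : g k \in L2 by exact: fL.
have e8lt (e : R) : 0 < e -> exists k, 8^-1 ^+ k < e.
  move=> e0; exists (Num.truncn e^-1).+1.
  rewrite exprVn -[ltRHS]invrK ltf_pV2 ?posrE ?invr_gt0 ?exprn_gt0//.
  apply: (lt_trans (truncnS_gt _)).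
  by rewrite -natrX ltr_nat ltn_expl.
have gC : Lfun2_cauchy g.
  move=> e /e8lt[k ke]; exists k => m n km kn.
  by apply: lt_trans ke; apply: HN; exact: sN.
(* The weight 4^k against the tolerance 8^-k leaves the summable 2^-k in the mean; a finite sum at x
   then forces increments of order 2^-k at x. *)
pose D k x := (4 ^+ k * (g k.+1 x - g k x) ^+ 2)%:E.
have D0 k x : (0 <= D k x)%E by rewrite lee_fin mulr_ge0 ?sqr_ge0.
have mD k : measurable_fun setT (D k).
  apply/measurable_EFinP; apply: measurable_funM => //.
  by apply: measurable_funX; apply: measurable_funB; exact: Lfun2_measurable.
have ID : (\int[mu]_x (\sum_(0 <= k <oo) D k x) < +oo)%E.
  rewrite integral_nneseries//.
  apply: (@le_lt_trans _ _ 2%:E); last by rewrite ltry.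
  apply: lime_le.
    by apply: is_cvg_nneseries => k _ _; exact: integral_ge0.
  apply: nearW => n.
  apply: (@le_trans _ _ (\sum_(0 <= k < n) (2^-1 ^+ k : R)%:E)%E).
    apply: lee_sum => k _.
    rewrite [leLHS](_ : _ =
        (4 ^+ k * ip mu (fun x => g k.+1 x - g k x) (fun x => g k.+1 x - g k x) : R)%:E).
      rewrite lee_fin (_ : 2^-1 ^+ k = 4 ^+ k * 8^-1 ^+ k :> R); last first.
        by rewrite -exprMn; congr (_ ^+ _); lra.
      by rewrite ler_pM2l ?exprn_gt0// ltW// HN// sN.
    rewrite EFinM -ip_sqE; last exact: Lfun2B.
    under eq_integral do rewrite /D EFinM.
    rewrite ge0_integralZl//.
    + apply/measurable_EFinP; apply: measurable_funX.
      by apply: measurable_funB; exact: Lfun2_measurable.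
    + by move=> x _; rewrite lee_fin sqr_ge0.
  rewrite sumEFin lee_fin.
  have -> : \sum_(0 <= k < n) 2^-1 ^+ k = 2 - 2 * 2^-1 ^+ n :> R.
    elim: n => [|n IH]; first by rewrite big_geq// expr0; ring.
    by rewrite big_nat_recr//= IH exprS; field.
  by rewrite gerBl mulr_ge0// exprn_ge0.
have gcvg : {ae mu, forall x, g n x @[n --> \oo] --> limfun g x}.
  have : mu.-integrable setT (fun x => \sum_(0 <= k <oo) D k x)%E.
    apply/integrableP; split; first by apply: ge0_emeasurable_sum.
    by under eq_integral do rewrite gee0_abs ?nneseries_ge0//.
  move=> /(integrable_ae measurableT); apply: filterS => x /(_ I) fin.
  apply: cvg_limfun.
  (* With S the sum of the [D k x], the bound S <= (1 + S)^2 replaces the square root of S by 1 +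
     S. *)
  have Dle k : `|g k.+1 x - g k x| <= (1 + fine (\sum_(0 <= k <oo) D k x)%E) * 2^-1 ^+ k.
    have : (D k x <= \sum_(0 <= k <oo) D k x)%E.
      apply: le_trans (nneseries_lim_ge k.+1 _); last by [].
      rewrite big_nat_recr//= leeDr// sume_ge0//.
    rewrite -{1}(fineK fin) lee_fin; set S := fine _ => DS.
    have S0 : 0 <= S by apply: le_trans DS; rewrite mulr_ge0 ?sqr_ge0.
    rewrite exprVn ler_pdivlMr ?exprn_gt0//.
    rewrite -(@ler_pXn2r _ 2)// ?nnegrE ?mulr_ge0 ?addr_ge0//.
    rewrite exprMn real_normK ?num_real// -exprM mulnC exprM.
    rewrite (_ : 2 ^+ 2 = 4 :> R); last by ring.
    rewrite mulrC; nra.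
  have /normed_cvg : cvgn [normed series (fun k => g k.+1 x - g k x)].
    apply: (@series_le_cvg _ _ (geometric (1 + fine (\sum_(0 <= k <oo) D k x)%E) 2^-1)).
    - by move=> k /=.
    - by move=> k; exact: le_trans (normr_ge0 _) (Dle k).
    - by move=> k; exact: Dle.
    - by apply: is_cvg_geometric_series; rewrite gtr0_norm//; lra.
  have := telescopeK (g ^~ x); rewrite /telescope /= => -> h.
  rewrite (_ : g ^~ x = (fun n => (g n x - g 0%N x) + g 0%N x)).
    by apply: is_cvgD => //; exact: is_cvg_cst.
  by apply/funext => n; rewrite subrK.
have [gL2 gc] := Lfun2_cauchy_ae_cvg gL gC
  (measurable_limfun (fun n => Lfun2_measurable (gL n))) gcvg.
split=> //.
(* From the subsequence to the whole sequence: a single far term of the subsequence is within e / 4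
   of the limit and of all late [f_ n], and 2 (e / 4) + 2 (e / 4) = e. *)
apply/cvgrPdist_lt => e e0; have e4 : 0 < e / 4 by rewrite divr_gt0.
have [k ke] := e8lt _ e4.
move/cvgrPdist_lt : gc => /(_ _ e4)[K _ /(_ (maxn K k) (leq_maxl _ _))].
rewrite /= !sub0r !normrN !ger0_norm ?ip_ge0// => gf.
exists (N k) => // n /= kn; rewrite sub0r normrN ger0_norm ?ip_ge0//.
apply: (le_lt_trans (ip_triangle (fL n) (gL (maxn K k)) gL2)).
have := HN k _ _ kn (sN _ _ (leq_maxr K k)); rewrite -/(g _) => h.
lra.
Qed.

End completeness.

(** * Projections and conditional expectations *)

Section projection.
Context d (T : measurableType d) (R : realType).
Variable mu : {measure set T -> \bar R}.
Local Notation L2 := (Lfun mu 2%:E).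
Local Notation ip := (ip mu).

(** Closedness is expressed as completeness: a Cauchy sequence of V has some representative of its
    limit in V. This suits a set of functions that are not identified modulo null sets. *)
Record closed_subspace (V : set (T -> R)) : Prop := ClosedSubspace {
  cs_Lfun : forall f, V f -> f \in L2 ;
  cs_0 : V (cst 0) ;
  cs_lin : forall (a : R) f g, V f -> V g -> V (fun x => a * f x + g x) ;
  cs_complete : forall f_, (forall n, V (f_ n)) -> Lfun2_cauchy mu f_ ->
    exists2 f, V f &
      ip (fun x => f_ n x - f x) (fun x => f_ n x - f x) @[n --> \oo] --> 0 }.

(** The parallelogram law for f - g and f - h, whose half-sum is the distance vector from f to the
    midpoint of g and h. *)
Lemma ip_parallelogram f g h : f \in L2 -> g \in L2 -> h \in L2 ->
  ip (fun x => g x - h x) (fun x => g x - h x) =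
  2 * ip (fun x => f x - g x) (fun x => f x - g x) +
  2 * ip (fun x => f x - h x) (fun x => f x - h x) -
  4 * ip (fun x => f x - (2^-1 * g x + 2^-1 * h x))
         (fun x => f x - (2^-1 * g x + 2^-1 * h x)).
Proof.
move=> fL gL hL; have [g2 h2] := (Lfun2Z 2^-1 gL, Lfun2Z 2^-1 hL).
rewrite (ipBsq fL (Lfun2D g2 h2)) (ipDsq g2 h2) (ipDr g2 h2 fL).
rewrite !ipZl// !ipZr// !ipBsq//; by field.
Qed.

Lemma Lfun2_projection V f : closed_subspace V -> f \in L2 ->
  exists2 v, V v & forall u, V u -> ip (fun x => f x - v x) u = 0.
Proof.
case=> VL V0 Vlin VC fL.
pose E : set R := [set ip (fun x => f x - v x) (fun x => f x - v x) | v in V].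
have hE : has_inf E.
  split; first by exists (ip (fun x => f x - 0) (fun x => f x - 0)), (cst 0).
  by exists 0 => _ [v _ <-]; exact: ip_ge0.
have Einf v : V v -> inf E <= ip (fun x => f x - v x) (fun x => f x - v x).
  by move=> Vv; apply: ge_inf; [case: hE|exists v].
have /choice[v Hv] (n : nat) : exists v, V v /\
    ip (fun x => f x - v x) (fun x => f x - v x) < inf E + n.+1%:R^-1.
  by have [_ [v Vv <-] lt] := inf_adherent (ltac:(by rewrite invr_gt0) : 0 < n.+1%:R^-1 :> R) hE; exists v.
have Vv n : V (v n) by case: (Hv n).
have vL n : v n \in L2 by exact: VL.
have vC : Lfun2_cauchy mu v.
  (* The midpoint of two approximate minimizers is in V, hence at squared distance at least [inf E];
     the law leaves twice the sum of the two excesses, each below e / 4. *)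
  move=> e e0; have [N Ne] : exists N, N.+1%:R^-1 < e / 4 :> R.
    exists (Num.truncn (e / 4)^-1).
    by rewrite -[ltRHS]invrK ltf_pV2 ?posrE ?invr_gt0 ?divr_gt0// truncnS_gt.
  have H n : (N <= n)%N -> n.+1%:R^-1 < e / 4 :> R.
    by move=> Nn; apply: le_lt_trans Ne; rewrite lef_pV2 ?posrE// ler_nat.
  exists N => m n Nm Nn; rewrite (ip_parallelogram fL)//.
  have h2 : V (fun x => 2^-1 * v m x + 2^-1 * v n x).
    have := Vlin 2^-1 _ _ (Vv m) (Vlin 2^-1 _ _ (Vv n) V0).
    by congr V; apply/funext => x /=; rewrite addr0.
  have /= := Einf _ h2.
  have := H _ Nm; have := H _ Nn; have := (Hv m).2; have := (Hv n).2.
  move: (n.+1%:R^-1) (m.+1%:R^-1) => a b; lra.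
have [w Vw vw] := VC v Vv vC; exists w => // u Vu.
have [wL uL] := (VL _ Vw, VL _ Vu).
have fwL := Lfun2B fL wL.
have wmin : ip (fun x => f x - w x) (fun x => f x - w x) <= inf E.
  have h : ip (fun x => f x - v n x) (fun x => f x - v n x) @[n --> \oo] -->
      ip (fun x => f x - w x) (fun x => f x - w x).
    apply: (@cvg_ip_sq _ _ _ mu (fun n x => f x - v n x)) => // [n|].
      exact: Lfun2B.
    rewrite [X in X @ _ --> _](_ : _ =
      fun n => ip (fun x => v n x - w x) (fun x => v n x - w x))//.
    by apply/funext => n; rewrite ip_distC; apply: eq_ip => x; ring.
  have h2 : inf E + n.+1%:R^-1 @[n --> \oo] --> inf E + 0.
    by apply: cvgD; [exact: cvg_cst|exact: cvg_harmonic].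
  rewrite -[leRHS]addr0; apply: ler_cvg_to h h2 _.
  by apply: nearW => n; apply/ltW/(Hv n).2.
set c := ip _ u.
have uu := ip_ge0 mu u.
(* Moving w along u by c / (1 + p), with p = [ip u u], lowers the squared distance by c^2 (2 + p) /
   (1 + p)^2, so minimality forces c = 0. The optimal step c / p would exclude u = 0. *)
have /= := Einf _ (Vlin (c / (1 + ip u u)) _ _ Vu Vw).
move=> /(le_trans wmin).
rewrite (_ : (fun x => f x - (_ * u x + w x)) =
   fun x => (f x - w x) - (c / (1 + ip u u)) * u x); last first.
  by apply/funext => x; ring.
rewrite (ipBsq fwL (Lfun2Z _ uL)) (ipZr _ uL fwL) (ipZl _ uL (Lfun2Z _ uL)) (ipZr _ uL uL) -/c.
set q := ip (fun x => f x - w x) _; set p := ip u u in uu *.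
have p1 : 0 < 1 + p by lra.
rewrite (_ : q - _ + _ = q - c ^+ 2 * ((2 + p) / (1 + p) ^+ 2)); last by field; lra.
rewrite lerBrDr gerDl => h.
have k0 : 0 < (2 + p) / (1 + p) ^+ 2 by rewrite divr_gt0 ?exprn_gt0//; lra.
move: h; rewrite pmulr_lle0// => h.
by apply/eqP; rewrite -sqrf_eq0 eq_le h sqr_ge0.
Qed.

End projection.

Section conditional_expectation.
Context d (T : measurableType d) (R : realType).
Variable P : probability T R.
Implicit Types G : set (set T).

Lemma integral_indicl (A : set T) (f : T -> R) :
  (\int[P]_(x in A) (f x)%:E = \int[P]_x (\1_A x * f x)%:E)%E.
Proof.
rewrite integral_mkcond; apply: eq_integral => x _.
by rewrite patchE indicE; case: ifP; rewrite ?mul1r ?mul0r.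
Qed.

Lemma Lfun2_indic (A : set T) : measurable A -> (\1_A : T -> R) \in Lfun P 2%:E.
Proof.
move=> mA; apply: Lfun2P => //.
apply: (@le_lt_trans _ _ (\int[P]_x 1%:E)%E).
  apply: ge0_le_integral => //.
  - apply/measurable_EFinP; apply: measurable_funX; exact: measurable_indic.
  - by move=> x _; rewrite lee_fin indicE; case: (_ \in _); rewrite ?expr1n ?expr0n.
by rewrite integral_cst// mul1e (le_lt_trans (probability_le1 _ _))// ltry.
Qed.

Lemma Lfun2_integrable (f : T -> R) : f \in Lfun P 2%:E -> P.-integrable setT (EFin \o f).
Proof.
move=> fL; apply/Lfun1_integrable; apply: Lfun_subset12 => //.
exact: fin_num_measure.
Qed.

Lemma integral_ip_indic (A : set T) (f : T -> R) : measurable A -> f \in Lfun P 2%:E ->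
  (\int[P]_(x in A) (f x)%:E = (ip P \1_A f)%:E)%E.
Proof. by move=> mA fL; rewrite integral_indicl ipE//; exact: Lfun2_indic. Qed.

Lemma bounded_Lfun2 (C : R) (f : T -> R) : measurable_fun setT f ->
  (forall x, `|f x| <= C) -> f \in Lfun P 2%:E.
Proof.
move=> mf fC; apply: Lfun2P => //.
apply: (@le_lt_trans _ _ (\int[P]_x (C ^+ 2)%:E)%E).
  apply: ge0_le_integral => //.
  - by move=> x _; rewrite lee_fin sqr_ge0.
  - by apply/measurable_EFinP; exact: measurable_funX.
  - by move=> x _; rewrite lee_fin -[leLHS]real_normK ?num_real// ler_pXn2r ?nnegrE ?(le_trans _ (fC x)).
rewrite integral_cst// lte_mul_pinfty ?lee_fin ?sqr_ge0//.
by rewrite (le_lt_trans (probability_le1 _ _))// ltry.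
Qed.

Lemma Lfun2_bounded_mul (C : R) (f g : T -> R) : measurable_fun setT f ->
  (forall x, `|f x| <= C) -> g \in Lfun P 2%:E -> (fun x => f x * g x) \in Lfun P 2%:E.
Proof.
move=> mf fC gL; have mg := Lfun2_measurable gL.
apply: Lfun2P; first exact: measurable_funM.
apply: (@le_lt_trans _ _ (\int[P]_x ((C * g x) ^+ 2)%:E)%E); last first.
  by rewrite ip_sqE ?ltry//; exact: Lfun2Z.
apply: ge0_le_integral => //.
- by move=> x _; rewrite lee_fin sqr_ge0.
- by apply/measurable_EFinP; apply: measurable_funX; exact: measurable_funM.
- by apply/measurable_EFinP; apply: measurable_funX; exact: measurable_funM.
- move=> x _; rewrite lee_fin !exprMn ler_wpM2r ?sqr_ge0//.
  by rewrite -[leLHS]real_normK ?num_real// ler_pXn2r ?nnegrE ?(le_trans _ (fC x)).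
Qed.

Section sub_sigma_algebra.
Import HBNNSimple.
Variable G : set (set T).
Hypotheses (sG : sigma_algebra setT G) (Gm : G `<=` measurable).

(** Simple functions with level sets in G give 0 by linearity, and dominated convergence under
    [|Y D|] carries this over to Y, bounded or not. *)
Lemma integral_orthogonal_ge0 (D Y : T -> R) : P.-integrable setT (EFin \o D) ->
  (forall B, G B -> (\int[P]_(x in B) (D x)%:E = 0)%E) ->
  measurable_wrt G Y -> (forall x, 0 <= Y x) ->
  P.-integrable setT (fun x => (Y x * D x)%:E) ->
  (\int[P]_x (Y x * D x)%:E = 0)%E.
Proof.
move=> iD D0 mY Y0 iYD.
have mY' : measurable_fun [set: g_sigma_algebraType G] (EFin \o Y).
  by apply/measurable_EFinP/measurable_wrtP.
(* The approximation is taken for the sigma-algebra G, not the ambient one, so that its level sets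
   lie in G. *)
pose Y_ := nnsfun_approx measurableT mY'.
have wY n : measurable_wrt G (Y_ n : T -> R) by apply/measurable_wrtP.
have GY n r : G (Y_ n @^-1` [set r]) by exact: (wY n [set r] (measurable_set1 r)).
have mY_ n : measurable_fun setT (Y_ n : T -> R).
  exact: (measurable_wrt_measurable Gm).
have mD : measurable_fun setT D by apply/measurable_EFinP; exact: (measurable_int P).
have i1 A : measurable A -> P.-integrable setT (fun x => (\1_A x * D x)%:E).
  move=> mA; apply: le_integrable iD => //.
    by apply/measurable_EFinP; exact: measurable_funM.
  move=> x _; rewrite lee_fin normrM ler_piMl// indicE.
  by case: (_ \in _); rewrite ?normr1 ?normr0.
have mYr n r : d.-measurable (Y_ n @^-1` [set r]) by exact/Gm/GY.
have Z n : (\int[P]_x (Y_ n x * D x)%:E = 0)%E.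
  under eq_integral do rewrite fimfunE fsbig_finite//= mulr_suml -sumEFin.
  under eq_integral do under eq_bigr do rewrite -mulrA EFinM.
  rewrite integral_sum//=; last first.
    by move=> r; apply: integrableZl => //; exact: i1.
  rewrite big1// => r _.
  rewrite integralZl//; last exact: i1.
  by rewrite -integral_indicl D0// mule0.
have YY x : Y_ n x @[n --> \oo] --> Y x.
  have h : (EFin \o (Y_ ^~ x)) n @[n --> \oo] --> (Y x)%:E.
    by apply: cvg_nnsfun_approx => // y _; rewrite lee_fin.
  exact: (fine_cvg h).
have YYle n x : Y_ n x <= Y x.
  rewrite -(cvg_lim _ (YY x))//.
  apply: nondecreasing_cvgn_le; last exact: (cvgP _ (YY x)).
  by move=> p q pq; exact/lefP/nd_nnsfun_approx.
have [] := @dominated_convergence _ T R P setT measurableT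
  (fun n x => (Y_ n x * D x)%:E) (fun x => (Y x * D x)%:E)
  (fun x => `|(Y x * D x)%:E|%E).
- by move=> n; apply/measurable_EFinP; exact: measurable_funM.
- exact: (measurable_int P).
- apply: nearW => x _; apply: cvg_EFin; first exact: nearW.
  exact: cvgMr_tmp.
- exact: integrable_abse.
- apply: nearW => x n _; rewrite !abse_EFin lee_fin !normrM ler_wpM2r//.
  by rewrite !ger0_norm.
move=> _ _; rewrite /= (_ : (fun n => _) = cst 0%E); last first.
  by apply/funext => n; rewrite Z.
by move=> /cvg_lim <-//; rewrite lim_cst.
Qed.

Lemma integral_orthogonal (D Y : T -> R) : P.-integrable setT (EFin \o D) ->
  (forall B, G B -> (\int[P]_(x in B) (D x)%:E = 0)%E) ->
  measurable_wrt G Y ->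
  P.-integrable setT (fun x => (Y x * D x)%:E) ->
  (\int[P]_x (Y x * D x)%:E = 0)%E.
Proof.
move=> iD D0 mY iYD.
have mD : measurable_fun setT D by apply/measurable_EFinP; exact: (measurable_int P).
(* The signs s = 1 and s = -1 give the positive and negative parts of Y; both are at most |Y|, so
   their products with D stay integrable. *)
have H (s : R) : `|s| = 1 ->
    let Z := fun x => Num.max (s * Y x) 0 in
    P.-integrable setT (fun x => (Z x * D x)%:E) /\
    (\int[P]_x (Z x * D x)%:E = 0)%E.
  move=> s1 Z.
  have mZ : measurable_wrt G Z.
    apply/measurable_wrtP => //; apply: measurable_maxr => //.
    by apply/(measurable_wrtP sG); exact: measurable_wrtZ.
  have iZD : P.-integrable setT (fun x => (Z x * D x)%:E).
    apply: le_integrable iYD => //.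
      apply/measurable_EFinP; apply: measurable_funM => //.
      exact: measurable_wrt_measurable mZ.
    move=> x _; rewrite !abse_EFin lee_fin !normrM ler_wpM2r//.
    rewrite /Z; case: (leP (s * Y x) 0) => _; first by rewrite normr0.
    by rewrite normrM s1 mul1r.
  split => //; apply: integral_orthogonal_ge0 => //.
  by move=> x; rewrite /Z le_max lexx orbT.
have [ip0 e0] := H 1 (normr1 _); have [im0 f0] := H (-1) (normrN1 _).
under eq_integral.
  move=> x _.
  rewrite (_ : Y x * D x = Num.max (1 * Y x) 0 * D x - Num.max (- 1 * Y x) 0 * D x).
    rewrite EFinB; over.
  rewrite -mulrBl mul1r mulN1r; congr (_ * _).
  case: (leP (Y x) 0) => Y0; first by rewrite max_l ?oppr_ge0// sub0r opprK.
  by rewrite max_r ?subr0// oppr_le0 ltW.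
by rewrite integralB//= e0 f0 sube0.
Qed.

Lemma Lfun2_orthogonal (D Y : T -> R) : D \in Lfun P 2%:E -> Y \in Lfun P 2%:E ->
  (forall B, G B -> (\int[P]_(x in B) (D x)%:E = 0)%E) ->
  measurable_wrt G Y -> ip P Y D = 0.
Proof.
move=> DL YL D0 mY; rewrite /ip /Rintegral integral_orthogonal//.
- exact: Lfun2_integrable.
- exact: Lfun2M_integrable.
Qed.

Definition Lfun2_wrt : set (T -> R) :=
  [set f | f \in Lfun P 2%:E /\ measurable_wrt G f].

Lemma closed_subspace_wrt : closed_subspace P Lfun2_wrt.
Proof.
split.
- by move=> f [].
- split; last exact: measurable_wrt_cst.
  by apply: Lfun2P => //; rewrite integral0_eq ?ltry// => x _; rewrite expr0n.
- move=> a f g [fL mf] [gL mg]; split; first by apply: Lfun2D => //; exact: Lfun2Z.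
  by apply: measurable_wrtD => //; exact: measurable_wrtZ.
- move=> f_ Vf fC; have [s [sL sc]] := Lfun2_complete (fun n => (Vf n).1) fC.
  exists (limfun (fun k => f_ (s k))) => //; split=> //.
  by apply: measurable_wrt_limfun => // n; case: (Vf (s n)).
Qed.

Lemma Lfun2_cond_exp (X : T -> R) : X \in Lfun P 2%:E ->
  exists2 Y, Lfun2_wrt Y & forall Z, Lfun2_wrt Z -> ip P (fun x => X x - Y x) Z = 0.
Proof. exact: (Lfun2_projection closed_subspace_wrt). Qed.

(** The bridge between the definition by integrals over events and orthogonality of residuals, which
    is what projections provide. *)
Lemma is_cond_expP (X Y : T -> R) : X \in Lfun P 2%:E -> Y \in Lfun P 2%:E ->
  measurable_wrt G Y ->
  (forall B, G B -> ip P (\1_B) (fun x => X x - Y x) = 0) <-> is_cond_exp P G X Y.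
Proof.
move=> XL YL mY; split=> [h|[_ _ h] B GB].
  split=> //; first exact: Lfun2_integrable.
  move=> B GB; have mB := Gm GB; rewrite !integral_ip_indic//; congr EFin.
  by apply/esym/eqP; rewrite -subr_eq0 -ipBr ?h//; exact: Lfun2_indic.
have mB := Gm GB; have := h B GB; rewrite !integral_ip_indic// => -[] e.
by rewrite ipBr ?e ?subrr//; exact: Lfun2_indic.
Qed.

End sub_sigma_algebra.
End conditional_expectation.

(** * The measure d<M> (x) dP on the predictable sigma-algebra *)

Section predictable_sets.
Context {R : realType} {d : measure_display} {Omega : measurableType d}.
Implicit Types (T : R) (F H : R -> set (set Omega)) (A C : set (R * Omega)).

(* unconstrained outside [0, T] x Omega, which makes this a sigma-algebra on the
   whole of R x Omega *)
Definition predictable_sets T F : set (set (R * Omega)) :=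
  [set A | <<s `[0, T] `*` setT, predictable_rectangles T F >>
             ((`[0, T] `*` setT) `&` A)].

(** Holds by unfolding; it makes predictability an instance of [measurable_wrt] for a sigma-algebra,
    with all its closure properties. *)
Lemma predictableE T F (X : R -> Omega -> R) :
  predictable T F X = measurable_wrt (predictable_sets T F) (fun x => X x.1 x.2).
Proof. by []. Qed.

Lemma sigma_algebra_predictable_sets T F :
  sigma_algebra setT (predictable_sets T F).
Proof.
rewrite /predictable_sets; set D := _ `*` setT.
have [s0 sC sU] := smallest_sigma_algebra D (predictable_rectangles T F).
split=> /=.
- by rewrite setI0.
- move=> A /sC; congr (<<s _, _ >> _).
  by apply/seteqP; split=> x /=; tauto.
- by move=> A_ /sU; rewrite setI_bigcupr.
Qed.

Lemma predictable_setsS T F H : 0 <= T -> (forall t, 0 <= t <= T -> H t `<=` F t) ->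
  predictable_sets T H `<=` predictable_sets T F.
Proof.
move=> T0 HF A; apply: sub_smallest2r; first exact: smallest_sigma_algebra.
move=> C [[B HB ->]|[s [t [B [s0 st tT HB ->]]]]]; [left|right].
  by exists B => //; apply: HF HB; rewrite lexx.
exists s, t, B; split=> //; apply: HF HB.
by rewrite s0 (le_trans (ltW st)).
Qed.

Lemma predictable_rectangles_subset T F C : 0 <= T -> predictable_rectangles T F C ->
  C `<=` `[0, T] `*` setT.
Proof.
move=> T0 [[B _ ->]|[s [t [B [s0 st tT _ ->]]]]] x /= [xC _]; split=> //=.
  by rewrite xC in_itv/= lexx.
move: xC; rewrite !in_itv/= => /andP[sx xt].
by rewrite (le_trans s0 (ltW sx)) (le_trans xt).
Qed.

Lemma setI_closed_predictable_rectangles T F : filtration T F -> 0 <= T ->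
  setI_closed (predictable_rectangles T F).
Proof.
move=> [sF mF] T0.
have FI t (A B : set Omega) : 0 <= t <= T -> F t A -> F t B -> F t (A `&` B).
  by move=> /sF[/sigma_algebraP[]// _ _ _ + _]; exact.
have F00 : F 0 set0 by have [[]] := sF 0 (ltac:(by rewrite lexx)).
(* Disjoint rectangles must meet in a generator; {0} x set0 is available even when T = 0, where
   there is no interval ]s, t]. *)
have E0 : predictable_rectangles T F set0.
  by left; exists set0 => //; rewrite setX0.
move=> _ _ [[B FB ->]|[s [t [B [s0 st tT FB ->]]]]]
  [[B' FB' ->]|[s' [t' [B' [s0' st' tT' FB' ->]]]]].
- left; exists (B `&` B'); first by apply: FI => //; rewrite lexx.
  by apply/seteqP; split => x /=; tauto.
- rewrite (_ : _ `&` _ = set0)//; apply/seteqP; split => // x /= [[-> _]] [].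
  by rewrite in_itv/= ltNge s0'.
- rewrite (_ : _ `&` _ = set0)//; apply/seteqP; split => // x /= [[+ _]] [x0 _].
  by rewrite x0 in_itv/= ltNge s0.
- have [ss|ss] := ltP (Num.max s s') (Num.min t t'); last first.
    rewrite (_ : _ `&` _ = set0)//; apply/seteqP; split => // x /=.
    rewrite !in_itv/= => -[[/andP[sx xt] _]] [/andP[sx' xt'] _].
    have : Num.max s s' < Num.min t t'.
      by rewrite (@lt_le_trans _ _ x.1)// ?gt_max ?le_min ?sx ?xt.
    by rewrite ltNge ss.
  right; exists (Num.max s s'), (Num.min t t'), (B `&` B').
  have sT : Num.max s s' <= T.
    by rewrite (le_trans (ltW ss))// ge_min tT.
  split => //.
  + by rewrite le_max s0.
  + by rewrite ge_min tT.
  + have s0s : 0 <= Num.max s s' <= T by rewrite le_max s0 sT.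
    apply: FI => //; [apply: mF FB|apply: mF FB'] => //; by rewrite le_max lexx ?orbT.
  + apply/seteqP; split => x /=; rewrite !in_itv/= gt_max le_min.
      by move=> [[/andP[-> ->] ?]] [/andP[-> ->] ?].
    by move=> [/andP[/andP[-> ->] /andP[-> ->]] []].
Qed.

End predictable_sets.

Lemma lebesgue_stieltjes_measure_itv (R : realType) (f : cumulative R R) (a b : R) :
  a <= b -> lebesgue_stieltjes_measure f `]a, b]%classic = (f b - f a)%:E.
Proof.
move=> ab; rewrite /lebesgue_stieltjes_measure/= /measure_extension measurable_mu_extE/=.
  exact: wlength_itv_bnd.
exact: is_ocitv.
Qed.

Section dMdP.
Context {R : realType} {d : measure_display} {Omega : measurableType d}.
Variables (P : probability Omega R) (T : R) (F : R -> set (set Omega)).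
Variable QV : Omega -> cumulative R R.
Hypotheses (T0 : 0 <= T) (fF : filtration T F).
Hypothesis mQV : forall t, 0 <= t <= T -> measurable_fun setT (fun w => QV w t).

Let D : set (R * Omega) := `[0, T] `*` setT.
Let I : set R := `]0, T].
Let sec w (A : set (R * Omega)) : set R := [set t | A (t, w)].
Local Notation m w := (lebesgue_stieltjes_measure (QV w)).
Let Y := g_sigma_algebraType (predictable_sets T F).

Let mI : measurable I. Proof. exact: measurable_itv. Qed.

Let mYE (A : set (R * Omega)) : measurable (A : set Y) = predictable_sets T F A.
Proof.
exact: (congr1 (@^~ A)
  (measurable_g_measurableTypeE (sigma_algebra_predictable_sets T F))).
Qed.

Let secD w A : sec w (D `&` A) `&` I = sec w A `&` I.
Proof.
apply/seteqP; split=> t; rewrite /I /D /= !in_itv/=; first by move=> [[_ ?]].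
move=> [At /andP[t0 tT]]; rewrite t0 tT; split=> //; split=> //; split=> //=.
by rewrite in_itv/= (ltW t0).
Qed.

Let m_fin w : (m w I < +oo)%E.
Proof. by rewrite lebesgue_stieltjes_measure_itv ?ltry. Qed.

Definition dMdP_fun (A : set Y) : \bar R := (\int[P]_w (m w (sec w A `&` I)))%E.

(** A pi-lambda argument: on a rectangle ]s, t] x B the mass of the section is the indicator of B
    times [QV w t - QV w s], measurable in w. Stability under proper differences rests on the finite
    mass of ]0, T]. *)
Let dynkin : <<s D, predictable_rectangles T F >> `<=`
  [set A | A `<=` D /\ (forall w, measurable (sec w A `&` I)) /\
           measurable_fun setT (fun w => m w (sec w A `&` I))].
Proof.
have DI w : sec w D `&` I = I.
  by rewrite -[D]setIT secD; apply/seteqP; split => t //= [].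
apply: lambda_system_subset.
- exact: setI_closed_predictable_rectangles.
- split.
  + by move=> A [].
  + split=> //; split=> [w|]; first by rewrite DI.
    under eq_fun do rewrite DI lebesgue_stieltjes_measure_itv//.
    by apply/measurable_EFinP; apply: measurable_funB; apply: mQV; rewrite ?lexx ?T0.
  + move=> A B BA [AD [mA kA]] [BD [mB kB]]; split; first by move=> x [/AD].
    have E w : sec w (A `\` B) `&` I = (sec w A `&` I) `\` (sec w B `&` I).
      by apply/seteqP; split => t; rewrite /sec/=; tauto.
    split=> [w|]; first by rewrite E; exact: measurableD.
    have ED w : m w (sec w (A `\` B) `&` I) =
        (m w (sec w A `&` I) - m w (sec w B `&` I))%E.
      rewrite E measureD; [|exact: mA|exact: mB|].
        by congr (_ - m w _)%E; apply/seteqP; split => t; rewrite /sec/=;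
          [tauto|move=> [Bt It]; split=> //; split=> //; exact: BA].
      apply: (le_lt_trans _ (m_fin w)); apply: le_measure => //; rewrite inE.
        exact: mA.
      exact: mI.
    under eq_fun do rewrite ED.
    exact: emeasurable_funB.
  + move=> A_ ndA HA; split; first by apply: bigcup_sub => i _; case: (HA i).
    have E w : sec w (\bigcup_i A_ i) `&` I = \bigcup_i (sec w (A_ i) `&` I).
      by rewrite setI_bigcupl.
    split=> [w|].
      by rewrite E; apply: bigcup_measurable => i _; case: (HA i) => _ [].
    apply: (emeasurable_fun_cvg (fun n w => m w (sec w (A_ n) `&` I))).
      by move=> n; case: (HA n) => _ [].
    move=> w _; rewrite E; apply: nondecreasing_cvg_mu.
    * by move=> n; have [_ [mAn _]] := HA n; exact: mAn.
    * by apply: bigcup_measurable => i _; have [_ [mAn _]] := HA i; exact: mAn.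
    * move=> i j ij; apply/subsetPset => t [At It]; split => //.
      by have /subsetPset := ndA _ _ ij; exact.
- move=> A rA; split; first exact: predictable_rectangles_subset rA.
  case: rA => [[B FB ->]|[s [t [B [s0 st tT FB ->]]]]].
    have E w : sec w ([set 0] `*` B) `&` I = set0.
      by apply/seteqP; split => // t; rewrite /sec/I/= => -[[-> _]]; rewrite in_itv/= ltxx.
    split=> [w|]; first by rewrite E.
    by under eq_fun do rewrite E measure0; exact: measurable_cst.
  have E w : sec w (`]s, t] `*` B) `&` I = if w \in B then `]s, t]%classic else set0.
    case: ifPn => wB; apply/seteqP; split => r //; rewrite /sec/I/=.
    + by move=> [[]].
    + rewrite !in_itv/= => /andP[sr rt].
      rewrite sr rt (le_lt_trans s0 sr) (le_trans rt tT).
      by split => //; split => //; exact: set_mem.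
    + by move=> [[_ /mem_set]]; rewrite (negbTE wB).
  split=> [w|]; first by rewrite E; case: ifP => _ //; exact: measurable_itv.
  under eq_fun => w.
    rewrite E (_ : m w _ = (\1_B w * (QV w t - QV w s))%:E); last first.
      rewrite indicE; case: ifP => _; rewrite ?measure0 ?mul0r// mul1r.
      by rewrite lebesgue_stieltjes_measure_itv// ltW.
    over.
  have sT : 0 <= s <= T by rewrite s0 (le_trans (ltW st)).
  have tT' : 0 <= t <= T by rewrite tT (le_trans s0 (ltW st)).
  apply/measurable_EFinP; apply: measurable_funM.
    by apply: measurable_indic; have [_] := fF.1 s sT; exact.
  by apply: measurable_funB; exact: mQV.
- apply: smallest_sub; last by move=> A /predictable_rectangles_subset; exact.
  split=> [|A AD|A_ AD] /=; [exact: sub0set|exact: subDsetl|].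
  by apply: bigcup_sub => i _; exact: AD.
Qed.

Let msec w A : predictable_sets T F A -> measurable (sec w A `&` I).
Proof. by move=> /dynkin[_ [/(_ w)]]; rewrite secD. Qed.

Let mker A : predictable_sets T F A ->
  measurable_fun setT (fun w => m w (sec w A `&` I)).
Proof. by move=> /dynkin[_ [_]]; under eq_fun do rewrite secD. Qed.

Let dMdP0 : dMdP_fun set0 = 0%E.
Proof.
rewrite /dMdP_fun integral0_eq// => w _.
by rewrite (_ : _ `&` _ = set0) ?measure0//; apply/seteqP; split => t //= [].
Qed.

Let dMdP_ge0 A : (0 <= dMdP_fun A)%E.
Proof. by apply: integral_ge0 => w _; exact: measure_ge0. Qed.

Let dMdP_sigma_additive : semi_sigma_additive dMdP_fun.
Proof.
move=> A_ mA tA mUA.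
rewrite (_ : dMdP_fun (\bigcup_n A_ n) = \sum_(0 <= i <oo) dMdP_fun (A_ i))%E.
  by apply: is_cvg_nneseries => n _ _; exact: dMdP_ge0.
rewrite /dMdP_fun -integral_nneseries//; last first.
  by move=> n; apply: mker; rewrite -mYE.
apply: eq_integral => w _.
have E : sec w (\bigcup_i A_ i) `&` I = \bigcup_i (sec w (A_ i) `&` I).
  by rewrite setI_bigcupl.
rewrite E measure_bigcup.
- by apply: eq_eseriesl => i; rewrite in_setT.
- by move=> i _; apply: msec; rewrite -mYE.
- move=> i j _ _ [t [[Ai _] [Aj _]]]; apply: tA => //; by exists (t, w).
Qed.

HB.instance Definition _ := isMeasure.Build _ Y R dMdP_fun
  dMdP0 dMdP_ge0 dMdP_sigma_additive.

Definition dMdP : {measure set Y -> \bar R} := dMdP_fun.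

Lemma dMdPE A : dMdP A =
  (\int[P]_w m w ([set t | A (t, w)] `&` `]0%R, T]%classic))%E.
Proof. by []. Qed.

Let measurable_section (f : Y -> \bar R) w : measurable_fun [set: Y] f ->
  measurable_fun I (fun t => f (t, w)).
Proof.
move=> mf _ B mB; rewrite setIC.
have := mf measurableT B mB; rewrite setTI => mfB.
by have := @msec w (f @^-1` B); apply; rewrite -mYE.
Qed.

Import HBNNSimple.

(** Measurability of the inner integral is carried along because the outer monotone convergence in
    [integral_dMdP] requires it. *)
Let integral_dMdP_nnsfun (f : {nnsfun Y >-> R}) :
  (\int[dMdP]_x (f x)%:E = \int[P]_w \int[m w]_(t in I) (f (t, w))%:E)%E /\
  measurable_fun setT (fun w => \int[m w]_(t in I) (f (t, w))%:E)%E.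
Proof.
have mf r : predictable_sets T F (f @^-1` [set r]) by rewrite -mYE.
pose A r w := sec w (f @^-1` [set r]) `&` I.
have mA r w : measurable (A r w) by exact: msec.
have A0 r w : r < 0 -> A r w = set0.
  move=> r0; apply/seteqP; split => // t [/=].
  by have /seteqP[+ _] := preimage_nnfun0 f r0 => /(_ (t, w)) /[apply].
have ge0 r w : (0 <= r%:E * m w (A r w))%E.
  have [r0|/A0 ->] := leP 0 r; last by rewrite measure0 mule0.
  by rewrite mule_ge0// lee_fin.
have ge0' r w t : 0 <= r * \1_(A r w) t.
  have [r0|/A0 ->] := leP 0 r; last by rewrite indic0 mulr0.
  by rewrite mulr_ge0.
have E w : (\int[m w]_(t in I) (f (t, w))%:E =
    \sum_(r \in range f) r%:E * m w (A r w))%E.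
  transitivity (\int[m w]_(t in I) \sum_(r \in range f) (r * \1_(A r w) t)%:E)%E.
    apply: eq_integral => t /set_mem It; rewrite fimfunE -fsumEFin//.
    apply: eq_fsbigr => r _; rewrite !indicE; congr ((_ * (nat_of_bool _)%:R)%:E).
    by apply/idP/idP; rewrite !inE /A /sec /=; [move=> ->|case].
  rewrite ge0_integral_fsum//; last first.
    by move=> r t _; rewrite lee_fin.
    move=> r; apply/measurable_EFinP; apply: measurable_funM => //.
    by apply: measurable_indic; exact: mA.
  apply: eq_fsbigr => r _.
  have /= -> := @integralZl_indic _ _ _ (m w) _ mI (A ^~ w) r (@A0 r w) (mA r w).
  rewrite integral_indic//; last exact: mA.
  by rewrite /A -setIA setIid.
have mEA r : measurable_fun setT (fun w => r%:E * m w (A r w))%E.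
  by apply: measurable_funeM; exact: mker.
split; last first.
  under eq_fun do rewrite E.
  by apply: emeasurable_fsum.
under [RHS]eq_integral do rewrite E.
rewrite ge0_integral_fsum//.
under eq_integral do rewrite fimfunE -fsumEFin//.
rewrite ge0_integral_fsum//; last 2 first.
- by move=> r; apply/measurable_EFinP; exact: measurable_funM.
- by move=> r x _; rewrite EFinM nnfun_muleindic_ge0.
apply: eq_fsbigr => r _.
rewrite (integralZl_indic _ (fun r => f @^-1` [set r]))//; last first.
  by move=> r0; rewrite preimage_nnfun0.
rewrite integral_indic// setIT.
have [r0|r0] := leP 0 r.
  by rewrite ge0_integralZl//; exact: mker.
rewrite preimage_nnfun0// measure0 mule0 integral0_eq// => w _.
by rewrite A0// measure0 mule0.
Qed.

(** A Tonelli theorem for a kernel, the inner measure depending on w; it identifies [dMdP_sqnorm]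
    with a squared norm in a genuine L^2 space. *)
Lemma integral_dMdP (f : Y -> \bar R) : measurable_fun [set: Y] f ->
  (forall x, (0 <= f x)%E) ->
  (\int[dMdP]_x f x = \int[P]_w \int[m w]_(t in I) f (t, w))%E.
Proof.
move=> mf f0; pose f_ := nnsfun_approx measurableT mf.
have f_f x : (f_ n x)%:E @[n --> \oo] --> f x by exact: cvg_nnsfun_approx.
have ndf x : {homo (fun n => (f_ n x)%:E) : n m / (n <= m)%N >-> (n <= m)%E}.
  by move=> p q pq; rewrite lee_fin; exact/lefP/nd_nnsfun_approx.
have mf_ n : measurable_fun [set: Y] (fun x => (f_ n x)%:E : \bar R).
  exact/measurable_EFinP.
transitivity (\int[dMdP]_x (limn (fun n => (f_ n x)%:E)))%E.
  by apply: eq_integral => x _; rewrite (cvg_lim _ (f_f x)).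
rewrite monotone_convergence//; last by move=> n x _; rewrite lee_fin.
transitivity (limn (fun n => \int[P]_w \int[m w]_(t in I) (f_ n (t, w))%:E))%E.
  by congr (limn _); apply/funext => n; exact: (integral_dMdP_nnsfun (f_ n)).1.
rewrite -monotone_convergence//; last 3 first.
- by move=> n; exact: (integral_dMdP_nnsfun (f_ n)).2.
- by move=> n w _; apply: integral_ge0 => t _; rewrite lee_fin.
- move=> w _ p q pq; apply: ge0_le_integral => //.
  + by move=> t _; rewrite lee_fin.
  + exact: (measurable_section w (mf_ p)).
  + exact: (measurable_section w (mf_ q)).
  + by move=> t _; exact: ndf.
apply: eq_integral => w _.
rewrite -monotone_convergence//.
- by apply: eq_integral => t _; rewrite (cvg_lim _ (f_f (t, w))).
- by move=> n; exact: (measurable_section w (mf_ n)).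
- by move=> n t _; rewrite lee_fin.
Qed.

End dMdP.

(** * Ito's isometry and the stochastic integral *)

Section ito.
Context {R : realType} {d : measure_display} {Omega : measurableType d}.
Variables (P : probability Omega R) (T : R) (F : R -> set (set Omega)).
Variables (M : R -> Omega -> R) (QV : Omega -> cumulative R R).
Hypotheses (T0 : 0 <= T) (fF : filtration T F).
Hypothesis martM : square_integrable_martingale P T F M.
Hypothesis qvM : predictable_quadratic_variation P T F M QV.

Local Notation ip := (ip P).
Local Notation L2 := (Lfun P 2%:E).

Let sF t : 0 <= t <= T -> sigma_algebra setT (F t).
Proof. by move=> /fF.1[]. Qed.

Let mF t : 0 <= t <= T -> F t `<=` measurable.
Proof. by move=> /fF.1[]. Qed.

Let ML t : 0 <= t <= T -> M t \in L2.
Proof. by have [_ _] := martM; exact. Qed.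

Let MF t : 0 <= t <= T -> measurable_wrt (F t) (M t).
Proof. by have [[h _ _] _ _] := martM; exact: h. Qed.

(** [QV] is the difference of M^2 and the martingale M^2 - [QV], both integrable. *)
Lemma integrable_quadratic_variation t : 0 <= t <= T ->
  P.-integrable setT (fun w => (QV w t)%:E).
Proof.
move=> tT; have [_ _ [_ /(_ t tT) h _]] := qvM.
have := integrableB measurableT (Lfun2_integrable_sqr (ML tT)) h.
by apply: eq_integrable => // w _ /=; rewrite -EFinB; congr EFin; ring.
Qed.

Lemma measurable_quadratic_variation t : 0 <= t <= T ->
  measurable_fun setT (fun w => QV w t).
Proof.
move=> /integrable_quadratic_variation h; apply/measurable_EFinP.
exact: (measurable_int P h).
Qed.

Let dM s t w := M t w - M s w.

Let dML s t : 0 <= s <= T -> 0 <= t <= T -> dM s t \in L2.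
Proof. by move=> sT tT; apply: Lfun2B; exact: ML. Qed.

Let dMF r s t : 0 <= s <= T -> 0 <= t <= T -> r <= T -> s <= r -> t <= r ->
  measurable_wrt (F r) (dM s t).
Proof.
move=> sT tT rT sr tr; have [s0 t0] := (andP sT, andP tT).
have rT' : 0 <= r <= T by rewrite rT (le_trans s0.1).
apply: (measurable_wrtB (sF rT')).
  by apply: measurable_wrtS (MF tT); apply: fF.2 => //; case: t0.
by apply: measurable_wrtS (MF sT); apply: fF.2 => //; case: s0.
Qed.

Lemma ip_martingale_increment (s t : R) Y : 0 <= s -> s <= t -> t <= T ->
  measurable_wrt (F s) Y -> Y \in L2 -> ip Y (fun w => M t w - M s w) = 0.
Proof.
move=> s0 st tT mY YL.
have sT' : 0 <= s <= T by rewrite s0 (le_trans st).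
have tT' : 0 <= t <= T by rewrite tT (le_trans s0 st).
apply: (Lfun2_orthogonal (sF sT') (mF sT')) => //; first exact: dML.
move=> B FB; have mB := mF sT' FB.
rewrite (integral_ip_indic mB (dML sT' tT')).
have [[_ _ /(_ s t s0 st tT)[_ _ /(_ B FB) e0]] _ _] := martM; move: e0.
rewrite (integral_ip_indic mB (ML sT')) (integral_ip_indic mB (ML tT')) => -[e].
by rewrite (ipBr (ML tT') (ML sT') (Lfun2_indic _ mB)) e subrr.
Qed.

(** With N = M^2 - QV, (M_t - M_s)^2 = (N_t - N_s) + (QV_t - QV_s) - 2 M_s (M_t - M_s). Tested
    against an F_s-measurable Z, the first and last terms vanish as martingale increments. *)
Lemma ip_sq_martingale_increment (s t : R) Z (C : R) : 0 <= s -> s <= t -> t <= T ->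
  measurable_wrt (F s) Z -> (forall w, `|Z w| <= C) ->
  ip (fun w => Z w * (M t w - M s w)) (fun w => M t w - M s w) =
  \int[P]_w (Z w * (QV w t - QV w s)).
Proof.
move=> s0 st tT FZ ZC.
have sT' : 0 <= s <= T by rewrite s0 (le_trans st).
have tT' : 0 <= t <= T by rewrite tT (le_trans s0 st).
have mZ := measurable_wrt_measurable (mF sT') FZ.
have ZL f : f \in L2 -> (fun w => Z w * f w) \in L2 by exact: (Lfun2_bounded_mul mZ ZC).
have bZ : [bounded Z w | w in [set: Omega]].
  exists C; split; first exact: num_real.
  by move=> x Cx w _; exact: le_trans (ZC w) (ltW Cx).
pose N t w := M t w ^+ 2 - QV w t.
have [_ _ [_ iN mN]] := qvM.
have iZ f : P.-integrable setT (EFin \o f) -> P.-integrable setT (fun w => (Z w * f w)%:E).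
  by move=> fi; apply: (integrableMr measurableT mZ bZ fi).
have iDN : P.-integrable setT (EFin \o (fun w => N t w - N s w)).
  by apply: eq_integrable (integrableB measurableT (iN t tT') (iN s sT')).
have iDQ : P.-integrable setT (EFin \o (fun w => QV w t - QV w s)).
  by apply: eq_integrable (integrableB measurableT (integrable_quadratic_variation tT')
    (integrable_quadratic_variation sT')).
have zN : \int[P]_w (Z w * (N t w - N s w)) = 0.
  rewrite /Rintegral (integral_orthogonal (sF sT') (mF sT') iDN)//; last exact: iZ.
  move=> B FB; have mB := mF sT' FB.
  under eq_integral do rewrite EFinB.
  rewrite integralB//; last 2 first.
    exact: integrableS (iN t tT').
    exact: integrableS (iN s sT').
  have [_ iNs /(_ B FB) e] := mN s t s0 st tT.
  rewrite /N in e *; rewrite -e subee//.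
  by apply: integrable_fin_num => //; exact: integrableS iNs.
have zM : ip (fun w => Z w * M s w) (fun w => M t w - M s w) = 0.
  apply: ip_martingale_increment => //; last by apply: ZL; exact: ML.
  by apply: measurable_wrtM => //; [exact: sF|exact: MF].
transitivity (\int[P]_w (Z w * (N t w - N s w)) + \int[P]_w (Z w * (QV w t - QV w s))
    + (-2) * ip (fun w => Z w * M s w) (fun w => M t w - M s w)); last first.
  by rewrite zN zM mulr0 addr0 add0r.
rewrite -RintegralD//; [|exact: iZ..].
have iI := Lfun2M_integrable (ZL _ (ML sT')) (dML sT' tT').
rewrite /ip -RintegralZl// -RintegralD//.
- by apply: eq_Rintegral => w _; rewrite /N; ring.
- by apply: eq_integrable (integrableD measurableT (iZ _ iDN) (iZ _ iDQ)).
- exact: (integrableZl measurableT (-2) iI).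
Qed.

(* the [d<M>]-measure of ]s, t] intersected with ]s', t'] *)
Definition bracket w (s t s' t' : R) : R :=
  let: (a, b) := (Num.max s s', Num.min t t') in QV w (Num.max a b) - QV w a.

Lemma bracketC w s t s' t' : bracket w s t s' t' = bracket w s' t' s t.
Proof. by rewrite /bracket (maxC s') (minC t'). Qed.

Let bounded_mul (Z Z' : Omega -> R) (C C' : R) : (forall w, `|Z w| <= C) ->
  (forall w, `|Z' w| <= C') -> forall w, `|Z w * Z' w| <= C * C'.
Proof. by move=> ZC ZC' w; rewrite normrM ler_pM. Qed.

(** If the intervals overlap, cut them at s' and at u = min(t, t'). Only the pair formed by ]s', u]
    with itself survives: any other pair either sets a later increment against an earlier factor or
    contains the empty one of ]u, t] and ]u, t']. *)
Let ip_martingale_increments_le (s t s' t' : R) Z Z' (C C' : R) :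
  0 <= s -> s <= t -> t <= T -> s <= s' -> s' <= t' -> t' <= T ->
  measurable_wrt (F s) Z -> measurable_wrt (F s') Z' ->
  (forall w, `|Z w| <= C) -> (forall w, `|Z' w| <= C') ->
  ip (fun w => Z w * (M t w - M s w)) (fun w => Z' w * (M t' w - M s' w)) =
  \int[P]_w (Z w * Z' w * bracket w s t s' t').
Proof.
move=> s0 st tT ss st' tT' FZ FZ' ZC ZC'.
have s0' := le_trans s0 ss.
have sTT : 0 <= s <= T by rewrite s0 (le_trans st).
have sTT' : 0 <= s' <= T by rewrite s0' (le_trans st').
have tTT : 0 <= t <= T by rewrite tT (le_trans s0 st).
have tTT' : 0 <= t' <= T by rewrite tT' (le_trans s0' st').
pose W w := Z w * Z' w.
have FsF : F s `<=` F s' by apply: fF.2 => //; case/andP: sTT'.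
have FW : measurable_wrt (F s') W.
  by apply: (measurable_wrtM (sF sTT')) => //; exact: measurable_wrtS FZ.
have mW := measurable_wrt_measurable (mF sTT') FW.
have WC := bounded_mul ZC ZC'.
have WL f : f \in L2 -> (fun w => W w * f w) \in L2 by exact: (Lfun2_bounded_mul mW WC).
transitivity (ip (fun w => W w * dM s t w) (dM s' t')).
  by apply: eq_Rintegral => w _; rewrite /W /dM; ring.
have [ts|ts] := leP t s'.
  rewrite ip_martingale_increment//; last by apply: WL; exact: dML.
    rewrite /Rintegral integral0_eq// => w _.
    rewrite /bracket (max_r ss) max_l ?subrr ?mulr0//.
    by rewrite ge_min ts.
  apply: (measurable_wrtM (sF sTT')) => //.
  by apply: dMF => //; case/andP: sTT'.
pose u := Num.min t t'.
have su : s' <= u by rewrite le_min (ltW ts).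
have uT : u <= T by rewrite ge_min tT.
have uTT : 0 <= u <= T by rewrite uT (le_trans s0' su).
have E1 : (fun w => W w * dM s t w) =
    (fun w => W w * dM s s' w + (W w * dM s' u w + W w * dM u t w)).
  by apply/funext => w; rewrite /dM; ring.
have E2 : dM s' t' = (fun w => dM s' u w + dM u t' w).
  by apply/funext => w; rewrite /dM; ring.
have WF r f : s' <= r -> r <= T -> measurable_wrt (F r) f ->
    measurable_wrt (F r) (fun w => W w * f w).
  move=> sr rT mf; have rTT : 0 <= r <= T by rewrite rT (le_trans s0').
  by apply: (measurable_wrtM (sF rTT)) => //; apply: measurable_wrtS FW; exact: fF.2.
have i1 : ip (fun w => W w * dM s s' w) (dM s' t') = 0.
  apply: ip_martingale_increment => //; last by apply: WL; exact: dML.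
  by apply: WF => //; [case/andP: sTT'|apply: dMF => //; case/andP: sTT'].
have i2 r : u <= r -> r <= T -> ip (fun w => W w * dM s' u w) (dM u r) = 0.
  move=> ur rT; apply: ip_martingale_increment => //; first by case/andP : uTT.
    by apply: WF => //; exact: dMF.
  by apply: WL; exact: dML.
have i3 : ip (fun w => W w * dM u t w) (dM u t') = 0.
  rewrite /ip /Rintegral integral0_eq// => w _.
  by rewrite /dM /u; case: (leP t t') => _; rewrite subrr ?mulr0 ?mul0r.
have i4 : ip (fun w => W w * dM u t w) (dM s' u) = 0.
  rewrite -(i2 t) ?ge_min ?lexx//.
  by apply: eq_Rintegral => w _; rewrite mulrAC.
have [[d1 d2] d3] := (dML sTT sTT', dML sTT' uTT, dML uTT tTT).
have [d4 d5] := (dML uTT tTT', dML sTT' tTT').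
rewrite E1 (ipDl (WL _ d1) (Lfun2D (WL _ d2) (WL _ d3)) d5) i1 add0r.
rewrite E2 (ipDl (WL _ d2) (WL _ d3) (Lfun2D d2 d4)).
rewrite (ipDr d2 d4 (WL _ d2)) (ipDr d2 d4 (WL _ d3)).
rewrite i3 i4 i2 ?ge_min ?lexx ?orbT// !addr0.
rewrite (ip_sq_martingale_increment s0' su uT FW WC).
by apply: eq_Rintegral => w _; rewrite /bracket (max_r ss) (max_r su).
Qed.

Lemma ip_martingale_increments (s t s' t' : R) Z Z' (C C' : R) :
  0 <= s -> s <= t -> t <= T -> 0 <= s' -> s' <= t' -> t' <= T ->
  measurable_wrt (F s) Z -> measurable_wrt (F s') Z' ->
  (forall w, `|Z w| <= C) -> (forall w, `|Z' w| <= C') ->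
  ip (fun w => Z w * (M t w - M s w)) (fun w => Z' w * (M t' w - M s' w)) =
  \int[P]_w (Z w * Z' w * bracket w s t s' t').
Proof.
move=> s0 st tT s0' st' tT' FZ FZ' ZC ZC'.
have [ss|/ltW ss] := leP s s'; first exact: (ip_martingale_increments_le (C := C) (C' := C')).
rewrite ipC (ip_martingale_increments_le s0' st' tT' ss st tT FZ' FZ ZC' ZC).
by apply: eq_Rintegral => w _; rewrite bracketC; ring.
Qed.


Implicit Type e : simple_integrand T F.

Let si_bounds e (i : 'I_(si_size e)) : [/\ 0 <= si_left i <= T, 0 <= si_right i <= T &
  si_left i <= si_right i].
Proof.
have [l0 lr rT] := si_itv i.
by split=> //; rewrite ?l0 ?rT ?(le_trans lr)// ?(le_trans l0).
Qed.

Let si_mul_L2 e (i : 'I_(si_size e)) f : f \in L2 -> (fun w => si_coef i w * f w) \in L2.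
Proof.
move=> fL; have [C ZC] := si_bounded i; have [lT _ _] := si_bounds i.
exact: (Lfun2_bounded_mul (measurable_wrt_measurable (mF lT) (si_meas i)) ZC).
Qed.

Let si_term e (i : 'I_(si_size e)) w := si_coef i w * (M (si_right i) w - M (si_left i) w).

Let si_term_L2 e (i : 'I_(si_size e)) : si_term i \in L2.
Proof. by apply: si_mul_L2; have [? ? _] := si_bounds i; exact: dML. Qed.

Lemma si_integral_Lfun2 e : si_integral M e \in L2.
Proof. by apply: Lfun2_sum => i; exact: si_term_L2. Qed.

(** Y is absorbed into each coefficient, which stays measurable at the left end of its interval. *)
Lemma ip_si_integral e Y : measurable_wrt (F 0) Y -> Y \in L2 ->
  ip Y (si_integral M e) = 0.
Proof.
move=> mY YL; rewrite ipC ip_suml//; last by move=> i; exact: si_term_L2.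
rewrite big1// => i _; have [lT rT lr] := si_bounds i.
have l0 : 0 <= si_left i by case/andP: lT.
have FF : F 0 `<=` F (si_left i) by apply: fF.2 => //; case/andP: lT.
rewrite -[RHS](@ip_martingale_increment (si_left i) (si_right i) (fun w => si_coef i w * Y w))//.
- by apply: eq_Rintegral => w _; rewrite /si_term; ring.
- by case/andP: rT.
- apply: (measurable_wrtM (sF lT)); first exact: si_meas.
  exact: measurable_wrtS mY.
- exact: si_mul_L2.
Qed.

Let integrable_bracket e (i j : 'I_(si_size e)) : P.-integrable setT (fun w => (si_coef i w *
  si_coef j w * bracket w (si_left i) (si_right i) (si_left j) (si_right j))%:E).
Proof.
have [[lT rT lr] [lT' rT' lr']] := (si_bounds i, si_bounds j).
have [[C ZC] [C' ZC']] := (si_bounded i, si_bounded j).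
have mi := measurable_wrt_measurable (mF lT) (si_meas i).
have mj := measurable_wrt_measurable (mF lT') (si_meas j).
have bZ : [bounded si_coef i w * si_coef j w | w in [set: Omega]].
  exists (C * C'); split; first exact: num_real.
  move=> x Cx w _; apply: le_trans (ltW Cx); exact: bounded_mul.
suff h : P.-integrable setT (fun w => (bracket w (si_left i) (si_right i)
    (si_left j) (si_right j))%:E).
  exact: (integrableMr measurableT (measurable_funM mi mj) bZ h).
rewrite /bracket; set a := Num.max (si_left i) (si_left j); set b := Num.max a _.
have aT : 0 <= a <= T.
  by rewrite /a le_max ge_max; case/andP : lT => -> ->; case/andP : lT' => _ ->.
have bT : 0 <= b <= T.
  case/andP : aT => a0 aT; case/andP : rT => _ rT.
  by rewrite /b le_max ge_max ge_min a0 aT rT.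
by apply: eq_integrable (integrableB measurableT (integrable_quadratic_variation bT)
  (integrable_quadratic_variation aT)).
Qed.

Let sqr_si_process e w : (\int[lebesgue_stieltjes_measure (QV w)]_(t in `]0%R, T])
    (si_process e t w ^+ 2)%:E =
  (\sum_(i < si_size e) \sum_(j < si_size e) si_coef i w * si_coef j w *
     bracket w (si_left i) (si_right i) (si_left j) (si_right j))%:E)%E.
Proof.
pose m : {measure set (measurableTypeR R) -> \bar R} :=
  lebesgue_stieltjes_measure (QV w).
pose lo (i j : 'I_(si_size e)) := Num.max (si_left i) (si_left j).
(* The maximum with [lo] turns disjoint intervals into the empty []lo, lo]], of mass 0, so that one
   formula covers all pairs. *)
pose hi (i j : 'I_(si_size e)) := Num.max (lo i j) (Num.min (si_right i) (si_right j)).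
pose A i j : set R := `]lo i j, hi i j]%classic.
have lohi i j : lo i j <= hi i j by rewrite le_max lexx.
have AI i j : A i j `<=` `]0, T]%classic.
  have [[lT rT _] [lT' _ _]] := (si_bounds i, si_bounds j).
  move=> t; rewrite /A /= !in_itv/= => /andP[lt th].
  rewrite (le_lt_trans _ lt)/=; last by rewrite le_max; case/andP : lT => ->.
  rewrite (le_trans th)// /hi ge_max ge_min/lo ge_max.
  by case/andP : lT => _ ->; case/andP : lT' => _ ->; case/andP : rT => _ ->.
have mA i j : measurable (A i j : set (measurableTypeR R)) by exact: measurable_itv.
have mI : measurable (`]0, T]%classic : set (measurableTypeR R)) by exact: measurable_itv.
have EA i j : m (A i j) =
    (bracket w (si_left i) (si_right i) (si_left j) (si_right j))%:E.
  exact: lebesgue_stieltjes_measure_itv.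
have iA i j (c : R) : m.-integrable `]0, T]%classic (fun t => (c * \1_(A i j) t)%:E).
  have : m.-integrable `]0, T]%classic (EFin \o (\1_(A i j) : measurableTypeR R -> R)).
    apply/integrableP; split; first by apply/measurable_EFinP; exact: measurable_indic.
    under eq_integral do rewrite /= ger0_norm//.
    by rewrite integral_indic// (setIidl (AI i j)) EA ltry.
  by move=> /(integrableZl mI c).
transitivity (\int[m]_(t in `]0%R, T])
   \sum_(i < si_size e) \sum_(j < si_size e) (si_coef i w * si_coef j w * \1_(A i j) t)%:E)%E.
  apply: eq_integral => t _; under eq_bigr do rewrite sumEFin.
  rewrite sumEFin; congr EFin.
  rewrite /si_process expr2 mulr_suml; apply: eq_bigr => i _.
  rewrite mulr_sumr; apply: eq_bigr => j _.
  rewrite mulrACA; congr (_ * _); rewrite !indicE -natrM mulnb.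
  congr (nat_of_bool _)%:R; rewrite /A !mem_setE !in_itv/= /hi le_max le_min.
  rewrite [t <= lo i j]leNgt /lo !gt_max.
  by case: (_ < t); case: (_ < t); case: (t <= _); case: (t <= _).
rewrite integral_sum//; last first.
  by move=> i; apply: integrable_sum.
rewrite -sumEFin; apply: eq_bigr => i _.
rewrite integral_sum//; rewrite -sumEFin; apply: eq_bigr => j _.
under eq_integral do rewrite EFinM.
rewrite integralZl//.
  by rewrite integral_indic// (setIidl (AI i j)) EA -EFinM.
by apply: eq_integrable (iA i j 1) => // t _; rewrite mul1r.
Qed.

(** The intervals of a simple integrand may overlap, so off-diagonal terms do not vanish in general;
    both sides expand into the same double sum of expected brackets. *)
Lemma ito_isometry_si_process e :
  dMdP_sqnorm P T QV (si_process e) = (ip (si_integral M e) (si_integral M e))%:E.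
Proof.
rewrite /dMdP_sqnorm; under eq_integral do rewrite sqr_si_process -sumEFin.
rewrite [X in X%:E](_ : _ = \sum_(i < si_size e) \sum_(j < si_size e) ip (si_term i) (si_term j)); last first.
  rewrite (ip_suml (si_term_L2 (e := e)) (si_integral_Lfun2 e)).
  apply: eq_bigr => i _; rewrite ipC (ip_suml (si_term_L2 (e := e)) (si_term_L2 i)).
  by apply: eq_bigr => j _; rewrite ipC.
under eq_integral do under eq_bigr do rewrite -sumEFin.
rewrite integral_sum//; last by move=> i; apply: integrable_sum.
rewrite -sumEFin; apply: eq_bigr => i _.
rewrite integral_sum// -sumEFin; apply: eq_bigr => j _.
have [[l0 lr rT] [l0' lr' rT']] := (si_itv i, si_itv j).
have [[C ZC] [C' ZC']] := (si_bounded i, si_bounded j).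
rewrite (ip_martingale_increments l0 lr rT l0' lr' rT'
  (si_meas i) (si_meas j) ZC ZC').
by rewrite fineK// integrable_fin_num.
Qed.

End ito.

(** * Predictability and linear combinations of simple integrands *)

Section simple_integrands.
Context {R : realType} {d : measure_display} {Omega : measurableType d}.
Variables (T : R) (F : R -> set (set Omega)).
Hypothesis fF : filtration T F.
Implicit Type e : simple_integrand T F.

Lemma si_process_predictable e :
  measurable_wrt (predictable_sets T F) (fun x => si_process e x.1 x.2).
Proof.
have sP := sigma_algebra_predictable_sets T F.
apply: (measurable_wrt_sum sP) => i; have [l0 lr rT] := si_itv i.
have [sP0 sPC _] := sP.
have rect B : measurable B ->
    predictable_sets T F (`]si_left i, si_right i] `*` (si_coef i @^-1` B)).
  move=> mB; have [lr'|lr'] := ltP (si_left i) (si_right i); last first.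
    by rewrite set_itv_ge ?set0X// bnd_simp -leNgt.
  rewrite /predictable_sets/= setIidr.
    apply: sub_sigma_algebra; right.
    exists (si_left i), (si_right i), (si_coef i @^-1` B); split => //.
    exact: si_meas.
  move=> x /= [+ _]; rewrite !in_itv/= => /andP[lx xr].
  by rewrite (le_trans l0 (ltW lx)) (le_trans xr).
(* The preimage of B under a coefficient times an indicator: a rectangle, together with everything
   outside the strip when 0 is in B. *)
have F0 B : measurable B -> predictable_sets T F
  ((`]si_left i, si_right i] `*` (si_coef i @^-1` B)) `|`
   (if 0 \in B then ~` (`]si_left i, si_right i] `*` setT) else set0)).
  move=> mB; rewrite -bigcup2E; case: sP => _ _; apply => -[|[|n]] //=; first exact: rect.
  case: ifP => // _; rewrite -setTD; apply: sPC.
  by have := rect setT measurableT; rewrite preimage_setT.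
move=> B mB; have := F0 B mB; congr (predictable_sets T F _).
apply/seteqP; split => -[t w] /=.
  rewrite /= indicE => -[[tlr Bw]|]; first by rewrite mem_set//= mulr1.
  case: ifPn => [/set_mem B0 h|//].
  by rewrite memNset ?mulr0// => tlr; apply: h.
rewrite indicE; have [/set_mem tlr|tlr] := boolP (_ \in _).
  by rewrite mulr1; left.
rewrite mulr0 => B0; right; rewrite mem_set// => -[/mem_set].
by rewrite (negbTE tlr).
Qed.

(** Overlapping intervals being allowed, a linear combination is the concatenation of the two
    families, with no common refinement. *)
Definition si_lin_size e1 e2 := (si_size e1 + si_size e2)%N.
Definition si_lin_left e1 e2 (i : 'I_(si_lin_size e1 e2)) : R :=
  match fintype.split i with inl j => si_left j | inr j => si_left j end.
Definition si_lin_right e1 e2 (i : 'I_(si_lin_size e1 e2)) : R :=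
  match fintype.split i with inl j => si_right j | inr j => si_right j end.
Definition si_lin_coef (a : R) e1 e2 (i : 'I_(si_lin_size e1 e2)) w : R :=
  match fintype.split i with inl j => a * si_coef j w | inr j => si_coef j w end.

Lemma si_lin_itv e1 e2 (i : 'I_(si_lin_size e1 e2)) :
  [/\ 0 <= si_lin_left i, si_lin_left i <= si_lin_right i & si_lin_right i <= T].
Proof. by rewrite /si_lin_left /si_lin_right; case: fintype.split => j; exact: si_itv. Qed.

Lemma si_lin_meas a e1 e2 (i : 'I_(si_lin_size e1 e2)) :
  measurable_wrt (F (si_lin_left i)) (si_lin_coef a i).
Proof.
rewrite /si_lin_left /si_lin_coef; case: fintype.split => j; last exact: si_meas.
have [l0 lr rT] := si_itv j.
apply: measurable_wrtZ (si_meas j); apply: (fF.1 _ _).1.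
by rewrite l0 (le_trans lr).
Qed.

Lemma si_lin_bounded a e1 e2 (i : 'I_(si_lin_size e1 e2)) :
  exists C : R, forall w, `|si_lin_coef a i w| <= C.
Proof.
rewrite /si_lin_coef; case: fintype.split => j; have [C jC] := si_bounded j; last by exists C.
by exists (`|a| * C) => w; rewrite normrM ler_wpM2l.
Qed.

Definition si_lin a e1 e2 : simple_integrand T F :=
  SimpleIntegrand (@si_lin_itv e1 e2) (@si_lin_meas a e1 e2) (@si_lin_bounded a e1 e2).

Lemma si_lin_process a e1 e2 t w :
  si_process (si_lin a e1 e2) t w = a * si_process e1 t w + si_process e2 t w.
Proof.
rewrite /si_process big_split_ord/= mulr_sumr; congr (_ + _); apply: eq_bigr => i _.
  rewrite /si_lin_coef /si_lin_left /si_lin_right.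
  by rewrite -[lshift _ i]/(unsplit (inl i)) unsplitK mulrA.
rewrite /si_lin_coef /si_lin_left /si_lin_right.
by rewrite -[rshift _ i]/(unsplit (inr i)) unsplitK.
Qed.

Lemma si_lin_integral a e1 e2 M w :
  si_integral M (si_lin a e1 e2) w = a * si_integral M e1 w + si_integral M e2 w.
Proof.
rewrite /si_integral big_split_ord/= mulr_sumr; congr (_ + _); apply: eq_bigr => i _.
  rewrite /si_lin_coef /si_lin_left /si_lin_right.
  by rewrite -[lshift _ i]/(unsplit (inl i)) unsplitK mulrA.
rewrite /si_lin_coef /si_lin_left /si_lin_right.
by rewrite -[rshift _ i]/(unsplit (inr i)) unsplitK.
Qed.

End simple_integrands.

(** * The integral as an L^2 limit: isometry, linearity, closedness *)

Section stochastic_integral.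
Context {R : realType} {d : measure_display} {Omega : measurableType d}.
Variables (P : probability Omega R) (T : R) (F : R -> set (set Omega)).
Variables (M : R -> Omega -> R) (QV : Omega -> cumulative R R).
Hypotheses (T0 : 0 <= T) (fF : filtration T F).
Hypothesis martM : square_integrable_martingale P T F M.
Hypothesis qvM : predictable_quadratic_variation P T F M QV.
Implicit Types (e : simple_integrand T F) (phi psi : R -> Omega -> R)
  (I J : Omega -> R).

Definition dMdP_measure := dMdP P T0 fF (measurable_quadratic_variation martM qvM).

Local Notation mu := dMdP_measure.
Local Notation L2 := (Lfun P 2%:E).
Local Notation L2mu := (Lfun mu 2%:E).

(** The type of the argument carries the predictable sigma-algebra on which [dMdP] is a measure. *)
Definition proc phi : g_sigma_algebraType (predictable_sets T F) -> R :=
  fun x => phi x.1 x.2.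

Let sP : sigma_algebra setT (predictable_sets T F).
Proof. exact: sigma_algebra_predictable_sets. Qed.

Let mproc phi : predictable T F phi -> measurable_fun setT (proc phi).
Proof. by rewrite predictableE => /(measurable_wrtP sP). Qed.

Lemma dMdP_sqnormE phi : predictable T F phi ->
  dMdP_sqnorm P T QV phi = (\int[mu]_x (proc phi x ^+ 2)%:E)%E.
Proof.
move=> /mproc mphi; rewrite integral_dMdP//.
  by apply/measurable_EFinP; exact: measurable_funX.
by move=> x; rewrite lee_fin sqr_ge0.
Qed.

Lemma proc_Lfun2P phi : predictable T F phi ->
  proc phi \in L2mu <-> (dMdP_sqnorm P T QV phi < +oo)%E.
Proof.
move=> pphi; rewrite dMdP_sqnormE//; split=> [/ip_sqE ->|]; first by rewrite ltry.
by apply: Lfun2P; exact: mproc.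
Qed.

Let predictable_si e : predictable T F (si_process e).
Proof. exact: si_process_predictable. Qed.

Let si_L2mu e : proc (si_process e) \in L2mu.
Proof.
by apply/proc_Lfun2P => //; rewrite (ito_isometry_si_process fF martM qvM) ltry.
Qed.

Let predictableB phi psi : predictable T F phi -> predictable T F psi ->
  predictable T F (fun t w => phi t w - psi t w).
Proof. by rewrite !predictableE; exact: measurable_wrtB. Qed.

(** An epsilon form of the definition: a single simple integrand is close both to phi and, after
    integration, to I. It spares the later proofs the handling of extended-real sequences. *)
Lemma is_stochastic_integralP phi I : predictable T F phi ->
  is_stochastic_integral P T F M QV phi I <->
  [/\ I \in L2, proc phi \in L2mu & forall r : R, 0 < r -> exists e,
    ip mu (fun x => proc (si_process e) x - proc phi x)
          (fun x => proc (si_process e) x - proc phi x) < r /\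
    ip P (fun w => si_integral M e w - I w) (fun w => si_integral M e w - I w) < r].
Proof.
move=> pphi; split=> [[IL [e [e_phi e_I]]]|[IL phiL H]].
  (* The distances are extended reals and finite only from some rank on; one approximant at finite
     distance already puts phi in L^2. *)
  have [fin_phi cphi] := iffLR (fine_cvgP _ _) e_phi.
  have phiL : proc phi \in L2mu.
    have [N _ /(_ N (leqnn N))/= finN] := fin_phi.
    have : proc (fun t w => si_process (e N) t w - phi t w) \in L2mu.
      apply/proc_Lfun2P; first exact: predictableB.
      by rewrite ltey_eq finN.
    move=> /(Lfun2B (si_L2mu (e N))).
    rewrite (_ : (fun x => _ - _) = proc phi)//.
    by apply/funext => x; rewrite /proc subKr.
  split=> // r r0.
  have E1 n : dMdP_sqnorm P T QV (fun t w => si_process (e n) t w - phi t w) =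
      (ip mu (fun x => proc (si_process (e n)) x - proc phi x)
             (fun x => proc (si_process (e n)) x - proc phi x))%:E.
    rewrite dMdP_sqnormE; last exact: predictableB.
    by rewrite -ip_sqE//; exact: Lfun2B.
  have E2 n : ('E_P[fun w => ((si_integral M (e n) w - I w) ^+ 2)%R] =
      (ip P (fun w => si_integral M (e n) w - I w) (fun w => si_integral M (e n) w - I w))%:E)%E.
    by rewrite unlock ip_sqE//; apply: Lfun2B => //; exact: si_integral_Lfun2.
  have [_ /cvgrPdist_lt/(_ _ r0) [N1 _ h1]] := iffLR (fine_cvgP _ _) e_phi.
  have [_ /cvgrPdist_lt/(_ _ r0) [N2 _ h2]] := iffLR (fine_cvgP _ _) e_I.
  exists (e (maxn N1 N2)); split.
    have := h1 _ (leq_maxl N1 N2); rewrite /= E1 /= sub0r normrN ger0_norm ?ip_ge0//.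
  have := h2 _ (leq_maxr N1 N2); rewrite /= E2 /= sub0r normrN ger0_norm ?ip_ge0//.
split=> //.
have /choice[e He] (n : nat) := H n.+1%:R^-1 (ltac:(by rewrite invr_gt0)).
exists e; split.
  have -> : (fun n => dMdP_sqnorm P T QV (fun t w => si_process (e n) t w - phi t w)) =
      (fun n => (ip mu (fun x => proc (si_process (e n)) x - proc phi x)
             (fun x => proc (si_process (e n)) x - proc phi x))%:E).
    apply/funext => n; rewrite dMdP_sqnormE; last exact: predictableB.
    by rewrite -ip_sqE//; exact: Lfun2B.
  apply: cvg_EFin; first exact: nearW.
  apply: (@cvg_ip_harmonic _ _ _ mu (fun n => proc (si_process (e n)))) => n.
  exact: (He n).1.
have -> : (fun n => 'E_P[fun w => ((si_integral M (e n) w - I w) ^+ 2)%R])%E =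
    (fun n => (ip P (fun w => si_integral M (e n) w - I w)
             (fun w => si_integral M (e n) w - I w))%:E).
  apply/funext => n; rewrite unlock ip_sqE//.
  by apply: Lfun2B => //; exact: si_integral_Lfun2.
apply: cvg_EFin; first exact: nearW.
apply: (@cvg_ip_harmonic _ _ _ P (fun n => si_integral M (e n))) => n.
exact: (He n).2.
Qed.

(** Both norms are limits along one sequence of simple integrands, for which they agree. *)
Lemma stochastic_integral_isometry phi I : predictable T F phi ->
  is_stochastic_integral P T F M QV phi I ->
  ip P I I = ip mu (proc phi) (proc phi).
Proof.
move=> pphi /(is_stochastic_integralP _ pphi)[IL phiL H].
have /choice[e He] (n : nat) := H n.+1%:R^-1 (ltac:(by rewrite invr_gt0)).
have h1 : ip mu (proc (si_process (e n))) (proc (si_process (e n))) @[n --> \oo] -->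
    ip mu (proc phi) (proc phi).
  apply: (@cvg_ip_sq _ _ _ mu (fun n => proc (si_process (e n)))) => //.
  apply: (@cvg_ip_harmonic _ _ _ mu (fun n => proc (si_process (e n)))) => n.
  exact: (He n).1.
have h2 : ip P (si_integral M (e n)) (si_integral M (e n)) @[n --> \oo] --> ip P I I.
  apply: (@cvg_ip_sq _ _ _ P (fun n => si_integral M (e n))) => //.
    by move=> n; exact: si_integral_Lfun2.
  apply: (@cvg_ip_harmonic _ _ _ P (fun n => si_integral M (e n))) => n.
  exact: (He n).2.
have E n : ip mu (proc (si_process (e n))) (proc (si_process (e n))) =
    ip P (si_integral M (e n)) (si_integral M (e n)).
  apply: EFin_inj; rewrite -ip_sqE// -dMdP_sqnormE//.
  exact: (ito_isometry_si_process fF martM qvM).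
rewrite -(cvg_lim _ h2)// -(cvg_lim _ h1)//.
by congr (limn _); apply/funext => n; rewrite E.
Qed.

Lemma ip_stochastic_integral phi I Y : predictable T F phi ->
  is_stochastic_integral P T F M QV phi I ->
  measurable_wrt (F 0) Y -> Y \in L2 -> ip P Y I = 0.
Proof.
move=> pphi /(is_stochastic_integralP _ pphi)[IL phiL H] mY YL.
have /choice[e He] (n : nat) := H n.+1%:R^-1 (ltac:(by rewrite invr_gt0)).
have : ip P (si_integral M (e n)) Y @[n --> \oo] --> ip P I Y.
  apply: cvg_ipl => //; first by move=> n; exact: si_integral_Lfun2.
  apply: (@cvg_ip_harmonic _ _ _ P (fun n => si_integral M (e n))) => n.
  exact: (He n).2.
rewrite ipC => /cvg_lim <-//.
rewrite [X in limn X](_ : _ = cst 0) ?lim_cst//; apply/funext => n.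
by rewrite ipC (ip_si_integral fF martM).
Qed.

Lemma is_stochastic_integral_lin (a : R) phi psi I J :
  predictable T F phi -> predictable T F psi ->
  is_stochastic_integral P T F M QV phi I ->
  is_stochastic_integral P T F M QV psi J ->
  is_stochastic_integral P T F M QV (fun t w => a * phi t w + psi t w)
    (fun w => a * I w + J w).
Proof.
move=> pphi ppsi /(is_stochastic_integralP _ pphi)[IL phiL HI].
move=> /(is_stochastic_integralP _ ppsi)[JL psiL HJ].
have plin : predictable T F (fun t w => a * phi t w + psi t w).
  by rewrite predictableE; apply: measurable_wrtD => //; exact: measurable_wrtZ.
apply/is_stochastic_integralP => //; split.
- by apply: Lfun2D => //; exact: Lfun2Z.
- by apply: (Lfun2D (Lfun2Z a phiL) psiL).
(* [ipD_le] weighs the two errors by 2 a^2 and 2; the tolerance is r divided by the total weight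
   plus 1. *)
move=> r r0; have b0 : 0 < 2 * a ^+ 2 + 3 by have := sqr_ge0 a; lra.
have r'0 : 0 < r / (2 * a ^+ 2 + 3) by rewrite divr_gt0.
have [e1 [h1 k1]] := HI _ r'0; have [e2 [h2 k2]] := HJ _ r'0.
have bound (x y : R) : 0 <= x -> 0 <= y -> x < r / (2 * a ^+ 2 + 3) ->
    y < r / (2 * a ^+ 2 + 3) -> 2 * (a * (a * x)) + 2 * y < r.
  rewrite !ltr_pdivlMr// => x0 y0 xr yr; have := sqr_ge0 a; nra.
exists (si_lin fF a e1 e2); split.
  have f1 := Lfun2B (si_L2mu e1) phiL; have f2 := Lfun2B (si_L2mu e2) psiL.
  have := ipD_le (Lfun2Z a f1) f2.
  rewrite (ipZl a f1 (Lfun2Z a f1)) (ipZr a f1 f1).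
  move=> /le_lt_trans h; have := h _ (bound _ _ (ip_ge0 _ _) (ip_ge0 _ _) h1 h2).
  rewrite (_ : (fun x => a * _ + _) =
    fun x => proc (si_process (si_lin fF a e1 e2)) x - (a * proc phi x + proc psi x))//.
  by apply/funext => x; rewrite /proc si_lin_process; ring.
have f1 := Lfun2B (si_integral_Lfun2 fF martM e1) IL.
have f2 := Lfun2B (si_integral_Lfun2 fF martM e2) JL.
have := ipD_le (Lfun2Z a f1) f2.
rewrite (ipZl a f1 (Lfun2Z a f1)) (ipZr a f1 f1).
move=> /le_lt_trans h; have := h _ (bound _ _ (ip_ge0 _ _) (ip_ge0 _ _) k1 k2).
rewrite (_ : (fun x => a * _ + _) =
  fun x => si_integral M (si_lin fF a e1 e2) x - (a * I x + J x))//.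
by apply/funext => x; rewrite si_lin_integral; ring.
Qed.

(** A simple integrand close to [phi_ n] and [I_ n], for one n far enough, is close to the limits;
    in [ip_triangle] the two errors r / 4 add up to r. *)
Lemma is_stochastic_integral_closed (phi_ : nat -> R -> Omega -> R)
    (I_ : nat -> Omega -> R) phi I :
  (forall n, predictable T F (phi_ n)) -> predictable T F phi ->
  (forall n, is_stochastic_integral P T F M QV (phi_ n) (I_ n)) ->
  proc phi \in L2mu -> I \in L2 ->
  ip mu (fun x => proc (phi_ n) x - proc phi x)
        (fun x => proc (phi_ n) x - proc phi x) @[n --> \oo] --> 0 ->
  ip P (fun w => I_ n w - I w) (fun w => I_ n w - I w) @[n --> \oo] --> 0 ->
  is_stochastic_integral P T F M QV phi I.
Proof.
move=> pphi_ pphi sphi phiL IL cphi cI.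
apply/is_stochastic_integralP => //; split => // r r0.
have r4 : 0 < r / 4 by rewrite divr_gt0.
have [N1 _ /(_ (maxn N1 _) (leq_maxl _ _)) h1] := (iffLR (cvgrPdist_lt _ _) cphi) _ r4.
have [N2 _ /(_ (maxn _ N2) (leq_maxr _ _)) h2] := (iffLR (cvgrPdist_lt _ _) cI) _ r4.
have := h1 N2; have := h2 N1; set n := maxn _ _.
rewrite /= !sub0r !normrN !ger0_norm ?ip_ge0// => k2 k1.
have [InL phinL /(_ _ r4)[e [e1 e2]]] := iffLR (is_stochastic_integralP (I_ n) (pphi_ n)) (sphi n).
exists e; split.
  by apply: (le_lt_trans (ip_triangle (si_L2mu e) phinL phiL)); lra.
apply: (le_lt_trans (ip_triangle (si_integral_Lfun2 fF martM e) InL IL)); lra.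
Qed.

End stochastic_integral.

(** * Cadlag versions of square-integrable martingales *)

Section greedy.
Context {R : realType}.
Implicit Types (x : nat -> R) (e : R).

(* [(a, k)]: the last value of [x] at which the path had moved by more than [e]
   since the previous such value, and the number of these moves *)
Fixpoint greedy x e n : R * nat :=
  if n isn't m.+1 then (x 0%N, 0%N) else
  let: (a, k) := greedy x e m in
  if e < `|x m.+1 - a| then (x m.+1, k.+1) else (a, k).

Definition anchor x e n := (greedy x e n).1.
Definition moves x e n := (greedy x e n).2.

Lemma anchorS x e n : anchor x e n.+1 =
  if e < `|x n.+1 - anchor x e n| then x n.+1 else anchor x e n.
Proof. by rewrite /anchor /=; case: greedy => a k /=; case: ifP. Qed.

Lemma movesS x e n : moves x e n.+1 =
  (moves x e n + (e < `|x n.+1 - anchor x e n|)%R)%N.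
Proof.
by rewrite /moves /anchor /=; case: greedy => a k /=; case: ifP; rewrite ?addn1 ?addn0.
Qed.

Lemma anchor_dist x e n : 0 <= e -> `|x n - anchor x e n| <= e.
Proof.
move=> e0; case: n => [|n]; first by rewrite /anchor/= subrr normr0.
by rewrite anchorS; case: ltP => //; rewrite subrr normr0.
Qed.

Lemma moves_le x e m n : (m <= n)%N -> (moves x e m <= moves x e n)%N.
Proof.
elim: n => [|n IH]; first by rewrite leqn0 => /eqP ->.
rewrite leq_eqVlt => /predU1P[->//|]; rewrite ltnS => /IH h.
by rewrite movesS (leq_trans h)// leq_addr.
Qed.

Lemma anchor_moves x e m n : (m <= n)%N -> moves x e m = moves x e n ->
  anchor x e m = anchor x e n.
Proof.
elim: n => [|n IH]; first by rewrite leqn0 => /eqP ->.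
rewrite leq_eqVlt => /predU1P[->//|]; rewrite ltnS => mn.
have := moves_le x e mn; rewrite movesS anchorS; case: ltP => _ /= h E.
  by move: h; rewrite E addn1 ltnn.
by apply: IH => //; rewrite E addn0.
Qed.

(** Without a move in between, both values lie within e of one common anchor. *)
Lemma moves_jump x e m n : 0 <= e -> (m <= n)%N -> 2 * e < `|x m - x n| ->
  (moves x e m < moves x e n)%N.
Proof.
move=> e0 mn; apply: contraTT; rewrite -leqNgt -leNgt => nm.
have E : moves x e m = moves x e n by apply/eqP; rewrite eqn_leq nm moves_le.
have := anchor_dist x m e0; have := anchor_dist x n e0; rewrite -(anchor_moves mn E) => h1 h2.
rewrite (_ : x m - x n = (x m - anchor x e m) - (x n - anchor x e m)); last by ring.
by apply: (le_trans (ler_normB _ _)); lra.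
Qed.

(** The squared distance to the anchor acts as a potential. Between moves, its increment is exactly
    that of x^2 minus twice the anchor times the increment of x; a move resets it to 0 and releases
    more than e^2. *)
Lemma moves_energy x e n : 0 <= e ->
  e ^+ 2 * (moves x e n)%:R + (x n - anchor x e n) ^+ 2 <=
  x n ^+ 2 - x 0%N ^+ 2 - 2 * \sum_(i < n) anchor x e i * (x i.+1 - x i).
Proof.
move=> e0; elim: n => [|n IH].
  by rewrite /moves /anchor/= big_ord0 !subrr mulr0 expr0n/= !mulr0 subr0 addr0.
rewrite big_ord_recr/= movesS anchorS.
set a := anchor x e n in IH *; set s := \sum_(_ < _) _ in IH *.
case: ltP => /= h; last first.
  by rewrite addn0; move: IH; nra.
rewrite subrr expr0n/= addr0 natrD mulrDr mulr1.
have : e ^+ 2 <= (x n.+1 - a) ^+ 2.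
  by rewrite -[leRHS]real_normK ?num_real// ler_pXn2r ?nnegrE// ltW.
by move: IH; nra.
Qed.

End greedy.

(** * From a monotone count to small oscillation on either side of a point *)

Section jump_count.
Context {R : realType}.
Variables (T : R) (D : set R) (x c : R -> R) (e : R).
Hypothesis c_le : forall r r', 0 <= r -> r <= r' -> r' <= T -> c r <= c r'.
Hypothesis c_jump : forall r r', 0 <= r -> r <= r' -> r' <= T -> D r -> D r' ->
  2 * e < `|x r - x r'| -> c r + 1 <= c r'.

(** Take u with c u less than 1 above the infimum of c on ]t, T]: a jump between t and u would lift
    c by 1 above a value that is at least this infimum, hence beyond c u. *)
Lemma jump_count_right t : 0 <= t -> t < T -> exists2 u, t < u <= T &
  forall r r', t < r < u -> t < r' < u -> D r -> D r' -> `|x r - x r'| <= 2 * e.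
Proof.
move=> t0 tT; pose E : set R := [set c r | r in `]t, T]].
have hE : has_inf E.
  split; first by exists (c T), T => //=; rewrite in_itv/= tT lexx.
  exists (c t) => _ [r /= + <-]; rewrite in_itv/= => /andP[tr rT].
  by apply: c_le => //; exact: ltW.
have [_ [u /= + <-] cu] := inf_adherent (@ltr01 R) hE.
rewrite in_itv/= => /andP[tu uT]; exists u; first by rewrite tu.
have H r r' : t < r -> r <= r' -> r' < u -> D r -> D r' -> `|x r - x r'| <= 2 * e.
  move=> tr rr ru Dr Dr'; rewrite leNgt; apply/negP.
  have r'T := ltW (lt_le_trans ru uT).
  move=> /(c_jump (ltW (le_lt_trans t0 tr)) rr r'T Dr Dr') h.
  have : c r' <= c u by apply: c_le => //; [exact: (le_trans t0 (ltW (lt_le_trans tr rr)))|exact: ltW].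
  have : inf E <= c r.
    by apply: ge_inf; [case: hE|exists r => //=; rewrite in_itv/= tr (le_trans rr)].
  lra.
move=> r r' /andP[tr ru] /andP[tr' ru'] Dr Dr'.
have [rr|/ltW rr] := leP r r'; first exact: H.
by rewrite distrC; exact: H.
Qed.

Lemma jump_count_left t : 0 < t -> t <= T -> exists2 u, 0 <= u < t &
  forall r r', u < r < t -> u < r' < t -> D r -> D r' -> `|x r - x r'| <= 2 * e.
Proof.
move=> t0 tT; pose E : set R := [set c r | r in `[0, t[].
have hE : has_sup E.
  split; first by exists (c 0), 0 => //=; rewrite in_itv/= t0 lexx.
  exists (c t) => _ [r /= + <-]; rewrite in_itv/= => /andP[tr rT].
  by apply: c_le => //; exact: ltW.
have [_ [u /= + <-] cu] := sup_adherent (@ltr01 R) hE.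
rewrite in_itv/= => /andP[tu uT]; exists u; first by rewrite tu.
have H r r' : u < r -> r <= r' -> r' < t -> D r -> D r' -> `|x r - x r'| <= 2 * e.
  move=> tr rr ru Dr Dr'; rewrite leNgt; apply/negP.
  have r'T := ltW (lt_le_trans ru tT).
  move=> /(c_jump (ltW (le_lt_trans tu tr)) rr r'T Dr Dr') h.
  have : c u <= c r by apply: c_le => //; [exact: ltW|exact: le_trans r'T].
  have : c r' <= sup E.
    by apply: ub_le_sup; [case: hE|exists r' => //=; rewrite in_itv/= ru
      (le_trans _ rr)// (ltW (le_lt_trans tu tr))].
  lra.
move=> r r' /andP[tr ru] /andP[tr' ru'] Dr Dr'.
have [rr|/ltW rr] := leP r r'; first exact: H.
by rewrite distrC; exact: H.
Qed.

End jump_count.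

(** * The expected number of moves along a discrete martingale *)

Section moves_expectation.
Context d (Omega : measurableType d) (R : realType).
Variable P : probability Omega R.
Variables (x : nat -> Omega -> R) (G : nat -> set (set Omega)) (e : R).
Hypothesis e0 : 0 <= e.
Hypothesis sG : forall n, sigma_algebra setT (G n).
Hypothesis mG : forall n, G n `<=` measurable.
Hypothesis GS : forall n, G n `<=` G n.+1.
Hypothesis xG : forall n, Lfun2_wrt P (G n) (x n).
Hypothesis x_orth : forall n Z, Lfun2_wrt P (G n) Z ->
  ip P Z (fun w => x n.+1 w - x n w) = 0.

Let xw w n := x n w.

(** Measurability follows the recursion; square-integrability comes from the distance to [x n],
    which is bounded by e. *)
Lemma anchor_wrt n : Lfun2_wrt P (G n) (fun w => anchor (xw w) e n).
Proof.
have mA : measurable_wrt (G n) (fun w => anchor (xw w) e n).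
  elim: n => [|n IH]; first exact: (xG 0).2.
  under eq_fun do rewrite anchorS.
  have mx := (xG n.+1).2.
  have mA := measurable_wrtS (@GS n) IH.
  apply/(measurable_wrtP (sG n.+1)).
  apply: measurable_fun_ifT.
  - apply: measurable_fun_ltr => //; apply: measurableT_comp => //.
    by apply: measurable_funB; exact/(measurable_wrtP (sG n.+1)).
  - exact/(measurable_wrtP (sG n.+1)).
  - exact/(measurable_wrtP (sG n.+1)).
split => //.
have mA' := measurable_wrt_measurable (@mG n) mA.
have : (fun w => x n w - anchor (xw w) e n) \in Lfun P 2%:E.
  apply: (@bounded_Lfun2 _ _ _ P e) => [|w]; last exact: anchor_dist.
  by apply: measurable_funB => //; exact: Lfun2_measurable (xG n).1.
move=> /(Lfun2B (xG n).1).
rewrite (_ : (fun w => _ - _) = (fun w => anchor (xw w) e n))//.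
by apply/funext => w; rewrite subKr.
Qed.

Lemma measurable_moves n : measurable_fun setT (fun w => (moves (xw w) e n)%:R : R).
Proof.
elim: n => [|n IH]; first exact: measurable_cst.
rewrite (_ : (fun w => _) = (fun w => (moves (xw w) e n)%:R +
    (if e < `|x n.+1 w - anchor (xw w) e n| then 1 else 0))); last first.
  by apply/funext => w; rewrite movesS natrD; case: ifP.
apply: measurable_funD => //; apply: measurable_fun_ifT => //.
apply: measurable_fun_ltr => //; apply: measurableT_comp => //.
apply: measurable_funB; first exact: Lfun2_measurable (xG _).1.
exact: Lfun2_measurable (anchor_wrt _).1.
Qed.

Lemma integral_moves n :
  ((e ^+ 2)%:E * \int[P]_w (moves (xw w) e n)%:R%:E <= (ip P (x n) (x n))%:E)%E.
Proof.
rewrite -ge0_integralZl//; last 2 first.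
- by apply/measurable_EFinP; exact: measurable_moves.
- by rewrite lee_fin sqr_ge0.
have iA (i : 'I_n) : P.-integrable setT
    (EFin \o (fun w => anchor (xw w) e i * (x i.+1 w - x i w))).
  apply: (Lfun2M_integrable (anchor_wrt i).1 _).
  exact: Lfun2B (xG _).1 (xG _).1.
have iS : P.-integrable setT
    (fun w => (\sum_(i < n) anchor (xw w) e i * (x i.+1 w - x i w))%:E).
  under eq_fun do rewrite -sumEFin.
  by apply: integrable_sum => // i _; exact: iA.
have iX : P.-integrable setT (fun w => (x n w ^+ 2)%:E).
  exact: Lfun2_integrable_sqr (xG n).1.
apply: (@le_trans _ _ (\int[P]_w (x n w ^+ 2 -
   2 * \sum_(i < n) anchor (xw w) e i * (x i.+1 w - x i w))%:E)%E).
  have h w : e ^+ 2 * (moves (xw w) e n)%:R <=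
      x n w ^+ 2 - 2 * \sum_(i < n) anchor (xw w) e i * (x i.+1 w - x i w).
    have := moves_energy (xw w) n e0; rewrite /= -/(xw w n).
    have := sqr_ge0 (x n w - anchor (xw w) e n).
    have := sqr_ge0 (x 0%N w); rewrite /xw; lra.
  apply: ge0_le_integral => //.
  - by move=> w _; rewrite -EFinM lee_fin mulr_ge0// sqr_ge0.
  - apply/measurable_EFinP; apply: measurable_funM => //; exact: measurable_moves.
  - apply/measurable_EFinP; apply: measurable_funB.
      by apply: measurable_funX; exact: Lfun2_measurable (xG n).1.
    by apply: measurable_funM => //; apply/measurable_EFinP; exact: (measurable_int P iS).
  - by move=> w _; rewrite -EFinM lee_fin.
under eq_integral do rewrite EFinB.
rewrite integralB//; last first.
  by under eq_fun do rewrite EFinM; exact: integrableZl.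
rewrite (ip_sqE (xG n).1).
under [X in (_ - X)%E]eq_integral do rewrite EFinM.
rewrite integralZl//.
under eq_integral do rewrite -sumEFin.
rewrite integral_sum//.
rewrite big1; first by rewrite mule0 sube0.
move=> i _.
rewrite ipE; [|exact: (anchor_wrt i).1|exact: Lfun2B (xG _).1 (xG _).1].
by rewrite x_orth//; exact: anchor_wrt.
Qed.

End moves_expectation.

(** * Dyadic grids of [0, T] *)

Section dyadic_grid.
Context {R : realType}.
Variable T : R.
Hypothesis T0 : 0 < T.

Definition dyadic_index n (r : R) : nat := Num.truncn (r * 2 ^+ n / T).
(** Capped at T, so that each grid is an infinite sequence of times of [0, T], as the discrete-time
    lemmas expect. *)
Definition dyadic_point n (j : nat) : R := Num.min T (j%:R * T / 2 ^+ n).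
(* the dyadic multiples of [T] in [0, T] *)
Definition dyadic : set R :=
  [set r | exists m, forall n, (m <= n)%N -> dyadic_point n (dyadic_index n r) = r].
(* the first point after [t] of the [n]-th grid *)
Definition dyadic_next (t : R) n : R := dyadic_point n (dyadic_index n t).+1.

Let p2 n : 0 < 2 ^+ n :> R. Proof. exact: exprn_gt0. Qed.

Lemma dyadic_point_itv n j : 0 <= dyadic_point n j <= T.
Proof.
rewrite /dyadic_point le_min ge_min lexx (ltW T0)/= andbT.
by rewrite divr_ge0 ?mulr_ge0// ltW.
Qed.

Lemma dyadic_point_le n i j : (i <= j)%N -> dyadic_point n i <= dyadic_point n j.
Proof.
move=> ij; rewrite /dyadic_point le_min ge_min lexx/= ge_min.
by rewrite ler_pM2r ?invr_gt0// ler_pM2r// ler_nat ij orbT.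
Qed.

Lemma dyadic_index_le n r r' : r <= r' -> (dyadic_index n r <= dyadic_index n r')%N.
Proof. by move=> rr; apply: le_truncn; rewrite ler_pM2r ?invr_gt0// ler_pM2r. Qed.

Lemma dyadic_dyadic_point m j : dyadic (dyadic_point m j).
Proof.
(* A capped point is T, the multiple of rank 2^m. *)
have [k ->] : exists2 k : nat, dyadic_point m j = k%:R * T / 2 ^+ m &
    k%:R * T / 2 ^+ m <= T.
  rewrite /dyadic_point; case: leP => h; last by exists j => //; exact: ltW.
  exists (2 ^ m)%N; rewrite natrX mulrC mulrA mulVf ?mul1r// gt_eqF.
move=> kT; exists m => n mn.
have E : k%:R * T / 2 ^+ m * 2 ^+ n / T = (k * 2 ^ (n - m))%:R.
  rewrite natrM natrX -{1}(subnK mn) exprD; field.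
  by rewrite !gt_eqF.
rewrite /dyadic_point /dyadic_index E natrK.
rewrite (_ : _ * T / 2 ^+ n = k%:R * T / 2 ^+ m); first exact/min_idPr.
rewrite natrM natrX -{2}(subnK mn) exprD; field.
by rewrite !gt_eqF.
Qed.

Lemma dyadic_next_gt t n : 0 <= t -> t < T -> t < dyadic_next t n.
Proof.
move=> t0 tT; rewrite /dyadic_next /dyadic_point lt_min tT/=.
rewrite ltr_pdivlMr// -ltr_pdivrMr//; exact: truncnS_gt.
Qed.

Lemma dyadic_next_le t n : dyadic_next t n <= T.
Proof. by have /andP[] := dyadic_point_itv n (dyadic_index n t).+1. Qed.

Lemma dyadic_next_near t u : 0 <= t -> t < u ->
  \forall n \near \oo, dyadic_next t n < u.
Proof.
move=> t0 tu; exists (Num.truncn (T / (u - t))) => // n /= Nn.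
have ut : 0 < u - t by rewrite subr_gt0.
rewrite /dyadic_next /dyadic_point gt_min; apply/orP; right.
apply: (@le_lt_trans _ _ ((t * 2 ^+ n / T + 1) * T / 2 ^+ n)).
  rewrite ler_pM2r ?invr_gt0// ler_pM2r// -natr1 lerD2r truncn_le.
  by rewrite divr_ge0 ?mulr_ge0// ltW.
rewrite (_ : _ / 2 ^+ n = t + T / 2 ^+ n); last by field; rewrite !gt_eqF.
rewrite -ltrBrDl ltr_pdivrMr// mulrC -ltr_pdivrMr//.
apply: (lt_le_trans (truncnS_gt _)).
by rewrite -natrX ler_nat (leq_ltn_trans Nn)// ltn_expl.
Qed.

Lemma dyadic_next_dyadic t n : dyadic (dyadic_next t n).
Proof. exact: dyadic_dyadic_point. Qed.

End dyadic_grid.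

(** * Regularization of the family of projections along the dyadic times *)

Section cadlag_version.
Context {R : realType} {d : measure_display} {Omega : measurableType d}.
Variables (P : probability Omega R) (T : R) (F : R -> set (set Omega)).
Hypotheses (T0 : 0 < T) (fF : filtration T F) (uF : usual_hypotheses P T F).
Variables (Y : Omega -> R).
Hypotheses (YL : Y \in Lfun P 2%:E) (YT : measurable_wrt (F T) Y).

Local Notation L2 := (Lfun P 2%:E).
Local Notation D := (dyadic T).

Let sF t : 0 <= t <= T -> sigma_algebra setT (F t).
Proof. by move=> /fF.1[]. Qed.

Let mF t : 0 <= t <= T -> F t `<=` measurable.
Proof. by move=> /fF.1[]. Qed.

Variable X : R -> Omega -> R.
Hypothesis XF : forall t, 0 <= t <= T -> Lfun2_wrt P (F t) (X t).
Hypothesis YX : forall t Z, 0 <= t <= T -> Lfun2_wrt P (F t) Z ->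
  ip P (fun w => Y w - X t w) Z = 0.

Let wrtS s t Z : 0 <= s -> s <= t -> t <= T -> Lfun2_wrt P (F s) Z -> Lfun2_wrt P (F t) Z.
Proof.
move=> s0 st tT [ZL mZ]; split=> //.
by apply: measurable_wrtS mZ; exact: fF.2.
Qed.

Let ipX t Z : 0 <= t <= T -> Lfun2_wrt P (F t) Z -> ip P (X t) Z = ip P Y Z.
Proof.
move=> tT FZ; have [XL _] := XF tT; have [ZL _] := FZ.
by apply/eqP; rewrite -subr_eq0 -opprB oppr_eq0 -(ipBl YL XL ZL) YX.
Qed.

Let ip_XX_le t : 0 <= t <= T -> ip P (X t) (X t) <= ip P Y Y.
Proof.
move=> tT; have [XL _] := XF tT.
have := ip_ge0 P (fun w => Y w - X t w).
by rewrite (ipBsq YL XL) -(ipX tT (XF tT)); lra.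
Qed.

Let ip_XB s t : 0 <= s -> s <= t -> t <= T ->
  ip P (fun w => X t w - X s w) (fun w => X t w - X s w) =
  ip P (X t) (X t) - ip P (X s) (X s).
Proof.
move=> s0 st tT.
have sT : 0 <= s <= T by rewrite s0 (le_trans st).
have tT' : 0 <= t <= T by rewrite tT (le_trans s0).
rewrite (ipBsq (XF tT').1 (XF sT).1) (ipX tT' (wrtS s0 st tT (XF sT))).
by rewrite -(ipX sT (XF sT)); ring.
Qed.

Let sampled n w j := X (dyadic_point T n j) w.
Let count (e : R) n r w : \bar R := (moves (sampled n w) e (dyadic_index T n r))%:R%:E.
(** The greedy count is not monotone under refinement of the grid (an extra point can shift an
    anchor and suppress a later move), so a lower limit replaces a supremum; Fatou bounds its
    expectation. *)
Let jumps e r w : \bar R := limn_einf (fun n => count e n r w).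

Let pT n j : 0 <= dyadic_point T n j <= T. Proof. exact: dyadic_point_itv. Qed.

Let point_le n j : F (dyadic_point T n j) `<=` F (dyadic_point T n j.+1).
Proof.
by apply: fF.2; [case/andP: (pT n j)|exact: dyadic_point_le|case/andP: (pT n j.+1)].
Qed.

Let sampled_orth n j Z : Lfun2_wrt P (F (dyadic_point T n j)) Z ->
  ip P Z (fun w => X (dyadic_point T n j.+1) w - X (dyadic_point T n j) w) = 0.
Proof.
move=> FZ; have [ZL mZ] := FZ.
have FZ' : Lfun2_wrt P (F (dyadic_point T n j.+1)) Z.
  by split => //; apply: measurable_wrtS mZ; exact: point_le.
rewrite (ipBr (XF (pT _ _)).1 (XF (pT _ _)).1 ZL) ![ip P Z _]ipC.
by rewrite (ipX (pT _ _) FZ) (ipX (pT _ _) FZ') subrr.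
Qed.

Let measurable_count e n r : 0 <= e -> measurable_fun setT (count e n r).
Proof.
move=> e0; apply/measurable_EFinP.
apply: (@measurable_moves _ _ _ P (fun j => X (dyadic_point T n j))
  (fun j => F (dyadic_point T n j))) => //.
- by move=> j; apply: sF; exact: pT.
- by move=> j; apply: mF; exact: pT.
- by move=> j; apply: XF; exact: pT.
Qed.

Let jumps_finite e : 0 < e -> {ae P, forall w, (jumps e T w < +oo)%E}.
Proof.
move=> e0.
have mj : measurable_fun setT (jumps e T).
  by apply: measurable_fun_limn_einf => n; apply: measurable_count; exact: ltW.
have j0 w : (0 <= jumps e T w)%E.
  rewrite -[leLHS](limn_einf_cst (R := R)); apply: le_limn_einf_near.
  by apply: nearW => n; rewrite lee_fin.
have : P.-integrable setT (jumps e T).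
  apply/integrableP; split=> //; under eq_integral do rewrite gee0_abs//.
  apply: (@le_lt_trans _ _ ((e ^+ 2)^-1 * ip P Y Y)%:E); last by rewrite ltry.
  apply: le_trans (fatou P measurableT _ _) _.
  - by move=> n; apply: measurable_count; exact: ltW.
  - by move=> n w _; rewrite lee_fin.
  rewrite -[leRHS](limn_einf_cst (R := R)); apply: le_limn_einf_near.
  apply: nearW => n; rewrite EFinM lee_pdivlMl ?exprn_gt0//.
  apply: (@le_trans _ _ (ip P (X (dyadic_point T n (dyadic_index T n T)))
      (X (dyadic_point T n (dyadic_index T n T))))%:E); last first.
    by rewrite lee_fin ip_XX_le.
  apply: (@integral_moves _ _ _ P (fun j => X (dyadic_point T n j))
    (fun j => F (dyadic_point T n j))).
  - exact: ltW.
  - by move=> j; apply: sF; exact: pT.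
  - by move=> j; apply: mF; exact: pT.
  - exact: point_le.
  - by move=> j; apply: XF; exact: pT.
  - exact: sampled_orth.
move=> /(integrable_ae measurableT); apply: filterS => w /(_ I).
by rewrite ltey_eq => ->.
Qed.

Let good w := forall k : nat, (jumps k.+1%:R^-1 T w < +oo)%E.

Let good_ae : {ae P, forall w, good w}.
Proof. by apply: ae_foralln => k; apply: jumps_finite; rewrite invr_gt0. Qed.

Let jumps_le e r r' w : r <= r' -> (jumps e r w <= jumps e r' w)%E.
Proof.
move=> rr; apply: le_limn_einf_near; apply: nearW => n.
by rewrite lee_fin ler_nat moves_le// dyadic_index_le.
Qed.

Let jumps_ge0 e r w : (0 <= jumps e r w)%E.
Proof.
rewrite -[leLHS](limn_einf_cst (R := R)); apply: le_limn_einf_near.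
by apply: nearW => n; rewrite lee_fin.
Qed.

Let jumps_jump e r r' w : 0 <= e -> r <= r' -> D r -> D r' ->
  2 * e < `|X r w - X r' w| -> (1 + jumps e r w <= jumps e r' w)%E.
Proof.
move=> e0 rr [m Dr] [m' Dr'] h; rewrite -limn_einf_shift//; apply: le_limn_einf_near.
(* From this grid on, r and r' are grid points, so the count compares [X r] and [X r']
   themselves. *)
exists (maxn m m') => // n /=; rewrite geq_max => /andP[mn mn'].
rewrite -EFinD lee_fin nat1r ler_nat; apply: moves_jump => //.
  exact: dyadic_index_le.
by rewrite /sampled Dr// Dr'.
Qed.

Let good_count w : good w -> forall e, 0 < e -> exists c : R -> R, exists2 e', 2 * e' <= e &
  (forall r r', 0 <= r -> r <= r' -> r' <= T -> c r <= c r') /\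
  (forall r r', 0 <= r -> r <= r' -> r' <= T -> D r -> D r' ->
     2 * e' < `|X r w - X r' w| -> c r + 1 <= c r').
Proof.
move=> gw e e0; pose k := Num.truncn (2 / e).
have ke : 2 * k.+1%:R^-1 <= e.
  by rewrite ler_pdivrMr// mulrC -ler_pdivrMr// ltW// truncnS_gt.
exists (fun r => fine (jumps k.+1%:R^-1 r w)), k.+1%:R^-1 => //.
have fin r : r <= T -> jumps k.+1%:R^-1 r w \is a fin_num.
  by move=> rT; rewrite ge0_fin_numE// (le_lt_trans (jumps_le _ _ rT)).
split=> [r r' r0 rr rT|r r' r0 rr rT Dr Dr' h].
  by apply: fine_le; [exact/fin/(le_trans rr)|exact: fin|exact: jumps_le].
have := jumps_jump (ltac:(by rewrite invr_ge0) : 0 <= k.+1%:R^-1 :> R) rr Dr Dr' h.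
rewrite -(fineK (fin r' rT)) -(fineK (fin r (le_trans rr rT))) -EFinD lee_fin addrC.
exact.
Qed.

Let good_right w t e : good w -> 0 <= t -> t < T -> 0 < e -> exists2 u, t < u <= T &
  forall r r', t < r < u -> t < r' < u -> D r -> D r' -> `|X r w - X r' w| <= e.
Proof.
move=> gw t0 tT /(good_count gw)[c [e' e'e [cle cj]]].
have [u tu H] := jump_count_right cle cj t0 tT; exists u => // r r' tr tr' Dr Dr'.
exact: le_trans (H _ _ tr tr' Dr Dr') e'e.
Qed.

Let good_left w t e : good w -> 0 < t -> t <= T -> 0 < e -> exists2 u, 0 <= u < t &
  forall r r', u < r < t -> u < r' < t -> D r -> D r' -> `|X r w - X r' w| <= e.
Proof.
move=> gw t0 tT /(good_count gw)[c [e' e'e [cle cj]]].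
have [u tu H] := jump_count_left cle cj t0 tT; exists u => // r r' tr tr' Dr Dr'.
exact: le_trans (H _ _ tr tr' Dr Dr') e'e.
Qed.


Let next := dyadic_next T.
(** The limit from the right along dyadic times: only countably many of the arbitrarily chosen
    versions [X t] enter the paths. *)
Let reg t w : R := limfun (fun n => X (next t n)) w.

Let next_between t u : 0 <= t -> t < T -> t < u -> \forall n \near \oo, t < next t n < u.
Proof.
move=> t0 tT tu; apply: filterS (dyadic_next_near T0 t0 tu) => n ->.
by rewrite andbT; exact: dyadic_next_gt.
Qed.

Let reg_cvg w t : good w -> 0 <= t -> t < T -> X (next t n) w @[n --> \oo] --> reg t w.
Proof.
move=> gw t0 tT; apply: cvg_limfun; apply/cauchy_cvgP/cauchy_exP => e e0.
have e2 : 0 < e / 2 by rewrite divr_gt0.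
have [u /andP[tu uT] H] := good_right gw t0 tT e2.
have [N _ HN] := next_between t0 tT tu.
exists (X (next t N) w); exists N => // n /= Nn.
rewrite -ball_normE /ball_/=; apply: (@le_lt_trans _ _ (e / 2)); last lra.
by apply: H; [exact: HN (leqnn N)|exact: HN|exact: dyadic_next_dyadic..].
Qed.

Let reg_right w t e : good w -> 0 <= t -> t < T -> 0 < e -> exists2 u, t < u <= T &
  forall s, t < s < u -> `|reg s w - reg t w| <= e.
Proof.
move=> gw t0 tT e0; have [u /andP[tu uT] H] := good_right gw t0 tT e0.
exists u => [|s /andP[ts su]]; first by rewrite tu.
have s0 : 0 <= s by rewrite (le_trans t0)// ltW.
have sT : s < T by exact: lt_le_trans uT.
have h : `|X (next s n) w - X (next t n) w| @[n --> \oo] --> `|reg s w - reg t w|.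
  by apply: cvg_norm; exact: (cvgB (reg_cvg gw s0 sT) (reg_cvg gw t0 tT)).
apply: (cvgr_to_le h).
apply: filterS2 (next_between s0 sT su) (next_between t0 tT tu) => n /andP[n1 n2] nt.
by apply: H; [rewrite (lt_trans ts)|exact: nt|exact: dyadic_next_dyadic..].
Qed.

Let reg_left w t e : good w -> 0 < t -> t <= T -> 0 < e -> exists2 u, 0 <= u < t &
  forall s s', u < s < t -> u < s' < t -> `|reg s w - reg s' w| <= e.
Proof.
move=> gw t0 tT e0; have [u /andP[u0 ut] H] := good_left gw t0 tT e0.
exists u => [|s s' /andP[us st] /andP[us' st']]; first by rewrite u0.
have s0 : 0 <= s by rewrite (le_trans u0)// ltW.
have s'0 : 0 <= s' by rewrite (le_trans u0)// ltW.
have sT : s < T by exact: lt_le_trans tT.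
have s'T : s' < T by exact: lt_le_trans tT.
have h : `|X (next s n) w - X (next s' n) w| @[n --> \oo] --> `|reg s w - reg s' w|.
  by apply: cvg_norm; exact: (cvgB (reg_cvg gw s0 sT) (reg_cvg gw s'0 s'T)).
apply: (cvgr_to_le h).
apply: filterS2 (next_between s0 sT st) (next_between s'0 s'T st') => n /andP[n1 n2] /andP[n3 n4].
apply: H; [by rewrite n2 (lt_trans us)|by rewrite n4 (lt_trans us')|exact: dyadic_next_dyadic..].
Qed.

(** The zero path off the good set makes every path cadlag, not only almost every one; at T there is
    no limit from the right, and Y itself is taken. *)
Let O t w : R := if `[< good w >] then (if t < T then reg t w else Y w) else 0.

Let O_cadlag : cadlag T O.
Proof.
move=> w; rewrite /O; case: asboolP => gw; last first.
  by split=> t _; [exact: cvg_cst|apply: is_cvg_cst].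
split=> t /andP[t0 tT].
  rewrite tT; apply/cvgrPdist_le => e e0.
  have [u /andP[tu uT] H] := reg_right gw t0 tT e0.
  near=> s.
  have su : s < u by near: s; exact: nbhs_right_lt.
  have ts : t < s by near: s; exact: nbhs_right_gt.
  by rewrite (lt_le_trans su uT) distrC H// ts.
apply/cauchy_cvgP/cauchy_exP => e e0.
have e2 : 0 < e / 2 by rewrite divr_gt0.
have [u /andP[u0 ut] H] := reg_left gw t0 tT e2.
exists (reg ((u + t) / 2) w); rewrite -ball_normE.
have : \forall s \near t^'-,
    `|reg ((u + t) / 2) w - (if s < T then reg s w else Y w)| < e; last by [].
near=> s.
have us : u < s by near: s; apply: nbhs_left_gt; exact: ut.
have st : s < t by near: s; exact: nbhs_left_lt.
rewrite (lt_le_trans st tT).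
apply: (@le_lt_trans _ _ (e / 2)); last lra.
apply: H; last by rewrite us.
by apply/andP; split; lra.
Unshelve. all: by end_near.
Qed.

(** Goodness depends on the path up to T; it belongs to every F_t through completeness, its
    complement being negligible. *)
Let F_good t : 0 <= t <= T -> F t [set w | good w].
Proof.
move=> tT; rewrite -[X in F t X]setCK.
have [_ FC _] := sF tT; rewrite -setTD; apply: FC.
by apply: uF.1 => //; exact: good_ae.
Qed.

(** For t < T, a limit from the right is measurable for F_s with any s > t; right-continuity of the
    filtration brings it down to F_t. *)
Let O_wrt t : 0 <= t <= T -> measurable_wrt (F t) (O t).
Proof.
move=> tT'; have /andP[t0] := tT'; rewrite le_eqVlt => /predU1P[tT|tT].
  rewrite (_ : O t = fun w => \1_[set w | good w] w * Y w).
    apply: (measurable_wrtM (sF tT')); last by rewrite tT.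
    by apply: (measurable_wrt_indic (sF tT')); exact: F_good.
  apply/funext => w; rewrite /O indicE tT ltxx; case: asboolP => gw.
    by rewrite mem_set// mul1r.
  by rewrite memNset// mul0r.
have H s : t < s -> s <= T -> measurable_wrt (F s) (O t).
  move=> ts sT; have sT' : 0 <= s <= T by rewrite sT (le_trans t0 (ltW ts)).
  (* Dropping the first N terms places all times in ]t, s[ without changing the limit on good
     paths. *)
  have [N _ HN] := next_between t0 tT ts.
  rewrite (_ : O t = fun w => \1_[set w | good w] w *
      limfun (fun n => X (next t (n + N)%N)) w).
    apply: (measurable_wrtM (sF sT')).
      by apply: (measurable_wrt_indic (sF sT')); exact: F_good.
    apply: (measurable_wrt_limfun (sF sT')) => n.
    have /andP[nt ns] := HN (n + N)%N (leq_addl _ _).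
    have nT : 0 <= next t (n + N)%N <= T by rewrite dyadic_next_le// (le_trans t0 (ltW nt)).
    apply: measurable_wrtS (XF nT).2; apply: fF.2 => //; last exact: ltW.
    by case/andP: nT.
  apply/funext => w; rewrite /O indicE tT; case: asboolP => gw; last first.
    by rewrite memNset// mul0r.
  rewrite mem_set// mul1r.
  have h := reg_cvg gw t0 tT.
  have h2 : X (next t (n + N)%N) w @[n --> \oo] --> reg t w.
    by rewrite -(cvg_shiftn N) in h; exact: h.
  have h3 := @cvg_limfun R _ (fun n => X (next t (n + N)%N)) w (cvgP _ h2).
  exact: (cvg_unique _ h2 h3).
move=> B mB; rewrite -(uF.2 t); last by rewrite t0.
by move=> s /=; rewrite in_itv/= => /andP[ts sT]; exact: H.
Qed.

Let O_T : {ae P, forall w, O T w = Y w}.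
Proof. by apply: filterS good_ae => w gw; rewrite /O asboolT// ltxx. Qed.

Let mO t : 0 <= t <= T -> measurable_fun setT (O t).
Proof. by move=> tT; exact: measurable_wrt_measurable (mF tT) (O_wrt tT). Qed.

Let O_reg t : 0 <= t -> t < T -> O t \in L2 /\
  ip P (fun w => X (next t n) w - O t w) (fun w => X (next t n) w - O t w) @[n --> \oo] --> 0.
Proof.
move=> t0 tT.
have nT n : 0 <= next t n <= T by rewrite dyadic_next_le// (le_trans t0)// ltW// dyadic_next_gt.
apply: Lfun2_cauchy_ae_cvg.
- by move=> n; exact: (XF (nT n)).1.
(* The squared norm of [X s] is nondecreasing in s, and its increments are the squared norms of
   increments; near its infimum on ]t, T] they are therefore small. *)
- move=> e e0; pose E : set R := [set ip P (X s) (X s) | s in `]t, T]].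
  have hE : has_inf E.
    split; first by exists (ip P (X T) (X T)), T => //=; rewrite in_itv/= tT lexx.
    by exists 0 => _ [s _ <-]; exact: ip_ge0.
  have [_ [u /= + <-] uE] := inf_adherent e0 hE.
  rewrite in_itv/= => /andP[tu uT].
  have [N _ HN] := next_between t0 tT tu; exists N => m n Nm Nn.
  have H s s' : t < s -> s <= s' -> s' < u ->
      ip P (fun w => X s' w - X s w) (fun w => X s' w - X s w) < e.
    move=> ts ss su; have s0 := ltW (le_lt_trans t0 ts).
    rewrite (ip_XB s0 ss (ltW (lt_le_trans su uT))).
    have h1 : inf E <= ip P (X s) (X s).
      apply: ge_inf; [by case: hE|exists s => //=].
      by rewrite in_itv/= ts (le_trans ss)// ltW// (lt_le_trans su).
    have h2 : ip P (X s') (X s') <= ip P (X u) (X u).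
      have := ip_ge0 P (fun w => X u w - X s' w).
      by rewrite (ip_XB (le_trans s0 ss) (ltW su) uT) subr_ge0.
    lra.
  have /andP[m1 m2] := HN _ Nm; have /andP[n1 n2] := HN _ Nn.
  have [nm|/ltW nm] := leP (next t n) (next t m); first exact: H.
  by rewrite ip_distC; exact: H.
- by apply: mO; rewrite t0 ltW.
- apply: filterS good_ae => w gw; rewrite /O asboolT// tT.
  exact: reg_cvg.
Qed.

Let O_L2 t : 0 <= t <= T -> O t \in L2.
Proof.
move=> tT'; have /andP[t0] := tT'; rewrite le_eqVlt => /predU1P[tT|tT].
  apply: (ae_eq_Lfun2 (mO tT') YL).
  by rewrite tT; apply: filterS O_T => w ->.
exact: (O_reg t0 tT).1.
Qed.

Let ip_O t Z : 0 <= t <= T -> Lfun2_wrt P (F t) Z -> ip P (O t) Z = ip P Y Z.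
Proof.
move=> tT' FZ; have /andP[t0] := tT'; rewrite le_eqVlt => /predU1P[tT|tT].
  have E : {ae P, forall w, O t w = Y w} by rewrite tT; exact: O_T.
  exact: (ae_eq_ip (O_L2 tT') YL FZ.1 E).
have [OL Ocvg] := O_reg t0 tT.
have nT n : 0 <= next t n <= T by rewrite dyadic_next_le// (le_trans t0)// ltW// dyadic_next_gt.
have h : ip P (X (next t n)) Z @[n --> \oo] --> ip P (O t) Z.
  apply: (@cvg_ipl _ _ _ P (fun n => X (next t n))) => //.
    by move=> n; exact: (XF (nT n)).1.
  by case: FZ.
rewrite -(cvg_lim _ h)// [X in limn X](_ : _ = cst (ip P Y Z)) ?lim_cst//.
apply/funext => n; apply: ipX => //; apply: wrtS FZ => //.
  by apply: ltW; exact: dyadic_next_gt.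
by case/andP : (nT n).
Qed.

Let O_martingale : square_integrable_martingale P T F O.
Proof.
split; [split|exact: O_cadlag|exact: O_L2].
- exact: O_wrt.
- by move=> t tT; apply: Lfun2_integrable; exact: O_L2.
- move=> s t s0 st tT.
  have sT : 0 <= s <= T by rewrite s0 (le_trans st).
  have tT' : 0 <= t <= T by rewrite tT (le_trans s0).
  apply: (iffLR (is_cond_expP (mF sT) (O_L2 tT') (O_L2 sT) (O_wrt sT))) => B FB.
  have BL : (\1_B : Omega -> R) \in L2 by apply: Lfun2_indic; exact: mF FB.
  have FZ : Lfun2_wrt P (F s) \1_B.
    by split => //; exact: (measurable_wrt_indic (sF sT)).
  rewrite (ipBr (O_L2 tT') (O_L2 sT) BL) ![ip P \1_B _]ipC.
  by rewrite (ip_O sT FZ) (ip_O tT' (wrtS s0 st tT FZ)) subrr.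
Qed.

Lemma cadlag_version_of_projections : exists2 O : R -> Omega -> R,
  square_integrable_martingale P T F O & {ae P, forall w, O T w = Y w}.
Proof. by exists O. Qed.

End cadlag_version.

Lemma cadlag_martingale_version (R : realType) d (Omega : measurableType d)
    (P : probability Omega R) (T : R) (F : R -> set (set Omega)) (Y : Omega -> R) :
  0 < T -> filtration T F -> usual_hypotheses P T F ->
  Y \in Lfun P 2%:E -> measurable_wrt (F T) Y ->
  exists2 O : R -> Omega -> R,
    square_integrable_martingale P T F O & {ae P, forall w, O T w = Y w}.
Proof.
move=> T0 fF uF YL YT.
have H t : exists X, 0 <= t <= T -> Lfun2_wrt P (F t) X /\
    forall Z, Lfun2_wrt P (F t) Z -> ip P (fun w => Y w - X w) Z = 0.
  have [tT|tT] := pselect (0 <= t <= T); last by exists (cst 0).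
  have [sF mF] := fF.1 t tT.
  by have [X XF YX] := Lfun2_cond_exp sF YL; exists X.
have [X HX] := choice H.
apply: (@cadlag_version_of_projections _ _ _ P T F T0 fF uF Y YL YT X).
- by move=> t /HX[].
- by move=> t Z /HX[_]; exact.
Qed.

(** * The space of integrals *)

Section integral_space.
Context {R : realType} {d : measure_display} {Omega : measurableType d}.
Variables (P : probability Omega R) (T : R) (F H : R -> set (set Omega)).
Variables (M : R -> Omega -> R) (QV : Omega -> cumulative R R).
Hypotheses (T0 : 0 <= T) (fF : filtration T F) (fH : filtration T H).
Hypothesis HF : forall t, 0 <= t <= T -> H t `<=` F t.
Hypothesis martM : square_integrable_martingale P T F M.
Hypothesis qvM : predictable_quadratic_variation P T F M QV.

Local Notation mu := (dMdP_measure T0 fF martM qvM).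
Local Notation proc := (@proc R d Omega T F).
Local Notation L2 := (Lfun P 2%:E).
Local Notation L2mu := (Lfun mu 2%:E).
Local Notation stochint := (is_stochastic_integral P T F M QV).

Let T00 : 0 <= (0 : R) <= T. Proof. by rewrite lexx. Qed.
Let sH0 : sigma_algebra setT (H 0). Proof. exact: (fH.1 0 T00).1. Qed.
Let HF0 : H 0 `<=` F 0. Proof. exact: HF. Qed.
Let mH0 : H 0 `<=` measurable. Proof. exact: (fH.1 0 T00).2. Qed.
Let sPH : sigma_algebra setT (predictable_sets T H).
Proof. exact: sigma_algebra_predictable_sets. Qed.

Lemma predictable_sub phi : predictable T H phi -> predictable T F phi.
Proof. by rewrite !predictableE; apply: measurable_wrtS; exact: predictable_setsS. Qed.

Lemma admissible_integrandP phi :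
  admissible_integrand P T H QV phi <-> predictable T H phi /\ proc phi \in L2mu.
Proof.
split=> -[pphi h]; split=> //; last exact/(proc_Lfun2P T0 fF martM qvM (predictable_sub pphi)).
exact/(proc_Lfun2P T0 fF martM qvM (predictable_sub pphi)).
Qed.

Lemma is_stochastic_integral0 : stochint (fun _ _ => 0 : R) (cst 0).
Proof.
have I0 (A : 'I_0 -> Prop) i : A i by case: i.
pose e := @SimpleIntegrand R d Omega T F 0 (fun=> 0 : R) (fun=> 0 : R) (fun _ => cst 0)
  (I0 _) (I0 _) (I0 _).
have e0 t w : si_process e t w = 0 by rewrite /si_process big_ord0.
have i0 w : si_integral M e w = 0 by rewrite /si_integral big_ord0.
split.
  by have := si_integral_Lfun2 fF martM e; rewrite (_ : si_integral M e = cst 0)//; apply/funext.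
exists (fun=> e); split.
  rewrite [X in X @ _ --> _](_ : _ = cst 0%E); first exact: cvg_cst.
  apply/funext => _ /=; rewrite /dMdP_sqnorm integral0_eq// => w _.
  by rewrite integral0_eq// => t _; rewrite e0 subr0 expr0n.
rewrite [X in X @ _ --> _](_ : _ = cst 0%E); first exact: cvg_cst.
apply/funext => _ /=; rewrite unlock integral0_eq// => w _.
by rewrite i0 subr0 expr0n.
Qed.

Lemma is_stochastic_integralB phi psi I J :
  predictable T F phi -> predictable T F psi -> stochint phi I -> stochint psi J ->
  stochint (fun t w => phi t w - psi t w) (fun w => I w - J w).
Proof.
move=> pphi ppsi sI sJ.
rewrite (_ : (fun t w => _) = fun t w => - 1 * psi t w + phi t w); last first.
  by apply/funext => t; apply/funext => w; rewrite mulN1r addrC.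
rewrite (_ : (fun w => _) = fun w => - 1 * J w + I w); last first.
  by apply/funext => w; rewrite mulN1r addrC.
exact: (is_stochastic_integral_lin T0 fF martM qvM (-1) ppsi pphi sJ sI).
Qed.

Lemma ip_dist_stochastic_integral phi psi I J :
  predictable T F phi -> predictable T F psi -> stochint phi I -> stochint psi J ->
  ip P (fun w => I w - J w) (fun w => I w - J w) =
  ip mu (fun x => proc phi x - proc psi x) (fun x => proc phi x - proc psi x).
Proof.
move=> pphi ppsi sI sJ.
apply: (stochastic_integral_isometry T0 fF martM qvM _ (is_stochastic_integralB pphi ppsi sI sJ)).
move: pphi ppsi; rewrite !predictableE.
exact: (measurable_wrtB (sigma_algebra_predictable_sets T F)).
Qed.

(** [integral_space] asks only measurability of U; square-integrability is recovered from eta -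
    I. *)
Lemma Lfun2_initial eta U I : measurable_wrt (H 0) U -> eta \in L2 -> I \in L2 ->
  {ae P, forall w, eta w = U w + I w} -> U \in L2.
Proof.
move=> mU etaL IL e; apply: (ae_eq_Lfun2 _ (Lfun2B etaL IL)).
  exact: measurable_wrt_measurable mU.
by apply: filterS e => w ->; rewrite addrK.
Qed.

Lemma ip_initial_stochastic_integral U phi I : measurable_wrt (H 0) U -> U \in L2 ->
  predictable T F phi -> stochint phi I -> ip P U I = 0.
Proof.
move=> mU UL pphi sI; apply: (ip_stochastic_integral T0 fF martM qvM pphi sI) => //.
exact: measurable_wrtS mU.
Qed.

(* Pythagoras, as [H_0]-measurable variables are orthogonal to stochastic integrals *)
Lemma ip_dist_integral_space eta eta' U U' phi phi' I I' :
  measurable_wrt (H 0) U -> measurable_wrt (H 0) U' ->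
  eta \in L2 -> eta' \in L2 ->
  predictable T F phi -> predictable T F phi' ->
  stochint phi I -> stochint phi' I' ->
  {ae P, forall w, eta w = U w + I w} -> {ae P, forall w, eta' w = U' w + I' w} ->
  ip P (fun w => eta w - eta' w) (fun w => eta w - eta' w) =
  ip P (fun w => U w - U' w) (fun w => U w - U' w) +
  ip mu (fun x => proc phi x - proc phi' x) (fun x => proc phi x - proc phi' x).
Proof.
move=> mU mU' eL eL' pphi pphi' sI sI' e e'.
have [IL IL'] := (sI.1, sI'.1).
have [UL UL'] := (Lfun2_initial mU eL IL e, Lfun2_initial mU' eL' IL' e').
have [dU dI] := (Lfun2B UL UL', Lfun2B IL IL').
have E : {ae P, forall w, eta w - eta' w = (U w - U' w) + (I w - I' w)}.
  by apply: filterS2 e e' => w -> ->; ring.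
rewrite (ae_eq_ip (Lfun2B eL eL') (Lfun2D dU dI) (Lfun2B eL eL') E).
rewrite ipC (ae_eq_ip (Lfun2B eL eL') (Lfun2D dU dI) (Lfun2D dU dI) E).
rewrite (ipDsq dU dI) (ip_dist_stochastic_integral pphi pphi' sI sI').
rewrite (@ip_initial_stochastic_integral (fun w => U w - U' w)
  (fun t w => phi t w - phi' t w) (fun w => I w - I' w))//.
- by rewrite mulr0 addr0.
- exact: (measurable_wrtB sH0).
- move: pphi pphi'; rewrite !predictableE.
  exact: (measurable_wrtB (sigma_algebra_predictable_sets T F)).
- exact: is_stochastic_integralB.
Qed.

Lemma closed_integral_space : closed_subspace P (integral_space P T F H M QV).
Proof.
split.
- by move=> eta [].
- have c0 : (cst 0 : Omega -> R) \in L2 by exact: is_stochastic_integral0.1.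
  split=> //; exists (cst 0), (fun _ _ => 0 : R), (cst 0); split.
  + exact: (measurable_wrt_cst sH0).
  + apply/admissible_integrandP; split; first exact: (measurable_wrt_cst sPH).
    have p0 : predictable T F (fun _ _ => 0 : R).
      exact: (measurable_wrt_cst (sigma_algebra_predictable_sets T F)).
    by have [] := iffLR (is_stochastic_integralP T0 fF martM qvM _ p0) is_stochastic_integral0.
  + exact: is_stochastic_integral0.
  + by apply: nearW => w; rewrite /= addr0.
- move=> a f g [fL [U [phi [I [mU /admissible_integrandP[pphi phiL] sI ef]]]]].
  move=> [gL [U' [phi' [I' [mU' /admissible_integrandP[pphi' phiL'] sI' eg]]]]].
  split; first by apply: Lfun2D => //; exact: Lfun2Z.
  exists (fun w => a * U w + U' w), (fun t w => a * phi t w + phi' t w),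
    (fun w => a * I w + I' w); split.
  + by apply: (measurable_wrtD sH0) => //; exact: (measurable_wrtZ sH0).
  + apply/admissible_integrandP; split; last exact: (Lfun2D (Lfun2Z a phiL) phiL').
    move: pphi pphi'; rewrite !predictableE => pphi pphi'.
    by apply: (measurable_wrtD sPH) => //; exact: (measurable_wrtZ sPH).
  + by apply: (is_stochastic_integral_lin T0 fF martM qvM) => //; exact: predictable_sub.
  + by apply: filterS2 ef eg => w -> ->; ring.
- move=> eta Veta etaC.
  have etaL n : eta n \in L2 := (Veta n).1.
  have /choice[u Hu] (n : nat) : exists u : (Omega -> R) * (R -> Omega -> R) * (Omega -> R),
      [/\ measurable_wrt (H 0) u.1.1, predictable T H u.1.2 /\ proc u.1.2 \in L2mu,
          stochint u.1.2 u.2 & {ae P, forall w, eta n w = u.1.1 w + u.2 w}].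
    have [_ [U [phi [I [mU /admissible_integrandP aphi sI e]]]]] := Veta n.
    by exists (U, phi, I).
  pose U n := (u n).1.1; pose phi n := (u n).1.2; pose I n := (u n).2.
  have mU n : measurable_wrt (H 0) (U n) by case: (Hu n).
  have pphi n : predictable T H (phi n) by case: (Hu n) => _ [].
  have phiL n : proc (phi n) \in L2mu by case: (Hu n) => _ [].
  have sI n : stochint (phi n) (I n) by case: (Hu n).
  have e n : {ae P, forall w, eta n w = U n w + I n w} by case: (Hu n).
  have IL n : I n \in L2 := (sI n).1.
  have UL n : U n \in L2 := Lfun2_initial (mU n) (etaL n) (IL n) (e n).
  have pF n := predictable_sub (pphi n).
  have dist m n := ip_dist_integral_space (mU m) (mU n) (etaL m) (etaL n) (pF m) (pF n)
    (sI m) (sI n) (e m) (e n).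
  have UC : Lfun2_cauchy P U.
    move=> r /etaC[N HN]; exists N => m n Nm Nn; apply: le_lt_trans (HN m n Nm Nn).
    by rewrite dist lerDl ip_ge0.
  have phiC : Lfun2_cauchy mu (fun n => proc (phi n)).
    move=> r /etaC[N HN]; exists N => m n Nm Nn; apply: le_lt_trans (HN m n Nm Nn).
    by rewrite dist lerDr ip_ge0.
  have IC : Lfun2_cauchy P I.
    move=> r /phiC[N HN]; exists N => m n Nm Nn; apply: le_lt_trans (HN m n Nm Nn).
    by rewrite (ip_dist_stochastic_integral (pF m) (pF n) (sI m) (sI n)).
  (* Three separate limits along unrelated subsequences; that [I0] is the integral of [phi0] comes
     from [is_stochastic_integral_closed]. *)
  have [s1 /=] := Lfun2_complete UL UC; set U0 := limfun _ => -[U0L cU].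
  have [s2 /=] := Lfun2_complete IL IC; set I0 := limfun _ => -[I0L cI].
  have [s3 /=] := Lfun2_complete phiL phiC; set phi0 := limfun _ => -[phi0L cphi].
  pose psi t w := phi0 (t, w).
  have psiE : proc psi = phi0 by apply/funext => -[].
  (* The L^2 space in use only sees F-predictability; H-predictability comes from the form of
     [phi0], a limsup of H-predictable processes. *)
  have ppsi : predictable T H psi.
    rewrite predictableE -[X in measurable_wrt _ X]/(proc psi) psiE.
    apply: (measurable_wrt_limfun sPH) => n; rewrite /= -[X in measurable_wrt _ X]/(proc (phi (s3 n))).
    exact: pphi.
  rewrite -psiE in phi0L cphi.
  exists (fun w => U0 w + I0 w).
    split; first exact: Lfun2D.
    exists U0, psi, I0; split.
    + by apply: (measurable_wrt_limfun sH0) => n; exact: mU.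
    + exact/admissible_integrandP.
    + apply: (is_stochastic_integral_closed (T0 := T0) (fF := fF) (martM := martM)
        (qvM := qvM) pF _ sI phi0L I0L cphi cI).
      exact: predictable_sub.
    + exact: nearW.
  apply: (@squeeze_cvgr _ _ _ _ (cst 0) (fun n =>
      2 * ip P (fun w => U n w - U0 w) (fun w => U n w - U0 w) +
      2 * ip P (fun w => I n w - I0 w) (fun w => I n w - I0 w))).
  + apply: nearW => n; rewrite ip_ge0/=.
    have dU := Lfun2B (UL n) U0L; have dI := Lfun2B (IL n) I0L.
    apply: le_trans (ipD_le dU dI).
    have VL := Lfun2D U0L I0L.
    have E : {ae P, forall w, eta n w - (U0 w + I0 w) = (U n w - U0 w) + (I n w - I0 w)}.
      by apply: filterS (e n) => w ->; ring.
    rewrite (ae_eq_ip (Lfun2B (etaL n) VL) (Lfun2D dU dI) (Lfun2B (etaL n) VL) E).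
    by rewrite ipC (ae_eq_ip (Lfun2B (etaL n) VL) (Lfun2D dU dI) (Lfun2D dU dI) E).
  + exact: cvg_cst.
  + rewrite [X in _ --> X](_ : _ = 2 * 0 + 2 * 0); last by rewrite !mulr0 addr0.
    exact: (cvgD (cvgMl_tmp (a := 2) cU) (cvgMl_tmp (a := 2) cI)).
Qed.

End integral_space.

(** * From vanishing L^2 distances to equality of martingales and of integrands *)

Lemma ae_eq_indistinguishable (R : realType) d (Omega : measurableType d)
    (P : probability Omega R) (T : R) (X X' : R -> Omega -> R) :
  0 < T -> cadlag T X -> cadlag T X' ->
  (forall t, 0 <= t <= T -> {ae P, forall w, X t w = X' t w}) ->
  indistinguishable P T X X'.
Proof.
move=> T0 cX cX' XX'.
(* Countably many grid points share one null set, and right-continuity recovers every t < T from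
   them; T is treated apart, having no times to its right. *)
have : {ae P, forall w, forall n j, X (dyadic_point T n j) w = X' (dyadic_point T n j) w}.
  by apply: ae_foralln => n; apply: ae_foralln => j; apply: XX'; exact: dyadic_point_itv.
have /XX' XT : 0 <= T <= T by rewrite lexx ltW.
apply: filterS2 XT => w XT XD t /andP[t0].
rewrite le_eqVlt => /predU1P[->//|tT].
have H (Z : R -> Omega -> R) : cadlag T Z -> Z (dyadic_next T t n) w @[n --> \oo] --> Z t w.
  move=> /(_ w)[/(_ t)]; rewrite t0 tT => /(_ isT) cZ _.
  apply/cvgrPdist_le => e e0.
  move/cvgrPdist_le : cZ => /(_ e e0)[r /= r0 Zr].
  have tr : t < t + r by rewrite ltrDl.
  apply: filterS (dyadic_next_near T0 t0 tr) => n nr.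
  have tn := dyadic_next_gt T0 n t0 tT.
  by apply: Zr => //=; rewrite /ball_ /= ler0_norm; lra.
have h := H _ cX; have h' := H _ cX'.
have E : (fun n => X' (dyadic_next T t n) w) = (fun n => X (dyadic_next T t n) w).
  by apply/funext => n; rewrite /dyadic_next XD.
by rewrite E in h'; exact: (cvg_unique _ h h').
Qed.

(** [Z = X_t - X'_t] is F_t-measurable, hence orthogonal to both increments from t to T, so E[Z^2] =
    E[Z (X_T - X'_T)] = 0. *)
Lemma martingale_ae_eq (R : realType) d (Omega : measurableType d)
    (P : probability Omega R) (T : R) (F : R -> set (set Omega)) (X X' : R -> Omega -> R) :
  filtration T F -> square_integrable_martingale P T F X ->
  square_integrable_martingale P T F X' ->
  {ae P, forall w, X T w = X' T w} ->
  forall t, 0 <= t <= T -> {ae P, forall w, X t w = X' t w}.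
Proof.
move=> fF mX mX' XT t tT; have /andP[t0 tT'] := tT.
have TT : 0 <= T <= T by rewrite (le_trans t0 tT') lexx.
have [[XF _ _] _ XL] := mX; have [[XF' _ _] _ XL'] := mX'.
pose Z w := X t w - X' t w.
have ZL : Z \in Lfun P 2%:E by apply: Lfun2B; [exact: XL|exact: XL'].
have FZ : measurable_wrt (F t) Z.
  by apply: (measurable_wrtB (fF.1 t tT).1); [exact: XF|exact: XF'].
have h := ip_martingale_increment fF mX t0 tT' (lexx T) FZ ZL.
have h' := ip_martingale_increment fF mX' t0 tT' (lexx T) FZ ZL.
move: h h'; rewrite (ipBr (XL _ TT) (XL _ tT) ZL) (ipBr (XL' _ TT) (XL' _ tT) ZL).
rewrite ![ip P Z (_ T)]ipC (ae_eq_ip (XL _ TT) (XL' _ TT) ZL XT) => h h'.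
have : ip P Z Z = 0.
  rewrite {2}/Z (ipBr (XL _ tT) (XL' _ tT) ZL) ipC (ipC _ Z); lra.
by move=> /(ip_sq_ae0 ZL); apply: filterS => w /eqP; rewrite subr_eq0 => /eqP.
Qed.

(** The set where the processes differ is predictable and null, and its mass unfolds to the iterated
    integral of [dMdP_ae_eq]. *)
Lemma dMdP_ae_eqP (R : realType) d (Omega : measurableType d)
    (P : probability Omega R) (T : R) (F : R -> set (set Omega))
    (M : R -> Omega -> R) (QV : Omega -> cumulative R R)
    (T0 : 0 <= T) (fF : filtration T F)
    (martM : square_integrable_martingale P T F M)
    (qvM : predictable_quadratic_variation P T F M QV) (phi psi : R -> Omega -> R) :
  let mu := dMdP_measure T0 fF martM qvM in
  predictable T F phi -> predictable T F psi ->
  @proc R d Omega T F phi \in Lfun mu 2%:E -> @proc R d Omega T F psi \in Lfun mu 2%:E ->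
  ip mu (fun x => @proc R d Omega T F phi x - @proc R d Omega T F psi x)
        (fun x => @proc R d Omega T F phi x - @proc R d Omega T F psi x) = 0 ->
  dMdP_ae_eq P T QV psi phi.
Proof.
move=> mu pphi ppsi phiL psiL /(ip_sq_ae0 (Lfun2B phiL psiL)) ae0.
pose f : g_sigma_algebraType (predictable_sets T F) -> R :=
  fun x => @proc R d Omega T F phi x - @proc R d Omega T F psi x.
have mf : measurable_fun setT f := Lfun2_measurable (Lfun2B phiL psiL).
pose A := ~` (f @^-1` [set 0]).
have mA : measurable A.
  by apply: measurableC; rewrite -[X in measurable X]setTI; exact: mf.
have A0 : mu A = 0%E by apply/(negligibleP mu mA); exact: ae0.
rewrite /dMdP_ae_eq -[RHS]A0 /mu /dMdP_measure dMdPE.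
apply: eq_integral => w _; congr (lebesgue_stieltjes_measure (QV w) _).
apply/seteqP; split => t /=; rewrite in_itv/= /f /proc/=.
  by move=> [-> h]; split => // /eqP; rewrite subr_eq0 => /eqP e; exact: h.
by move=> [h ->]; split => // e; apply: h; change (phi t w - psi t w = 0); rewrite e subrr.
Qed.

(** * The decomposition: existence, uniqueness and conditional expectations at time 0 *)

Theorem proposition3p2 (R : realType) (d : measure_display)
    (Omega : measurableType d) (P : probability Omega R) (T : R)
    (F H : R -> set (set Omega)) (M : R -> Omega -> R)
    (QV : Omega -> cumulative R R) (xi : Omega -> R)
    (T_gt0 : 0 < T)
    (filtrationF : filtration T F) (usualF : usual_hypotheses P T F)
    (F_T : F T = @measurable d Omega)
    (filtrationH : filtration T H) (usualH : usual_hypotheses P T H)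
    (subHF : forall t, 0 <= t <= T -> H t `<=` F t)
    (martM : square_integrable_martingale P T F M)
    (qvM : predictable_quadratic_variation P T F M QV)
    (xiL2 : xi \in Lfun P 2%:E) :
  exists (U : Omega -> R) (phi : R -> Omega -> R) (O : R -> Omega -> R),
    [/\ decomposition P T F H M QV xi U phi O,
        forall U' phi' O', decomposition P T F H M QV xi U' phi' O' ->
          [/\ {ae P, forall w, U' w = U w},
              dMdP_ae_eq P T QV phi' phi &
              indistinguishable P T O' O],
        is_cond_exp P (H 0) xi U,
        is_cond_exp P (H 0) (O T) (cst 0) &
        {ae P, forall w, O 0 w = 0} <-> is_cond_exp P (F 0) xi U].
Proof.
have T0 : 0 <= T := ltW T_gt0.
have T00 : 0 <= (0 : R) <= T by rewrite lexx.
have TT : 0 <= T <= T by rewrite lexx T0.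
pose V := integral_space P T F H M QV.
have VC : closed_subspace P V := closed_integral_space T0 filtrationF filtrationH subHF martM qvM.
have [_ V0 Vlin _] := VC.
have [sH0 mH0] := filtrationH.1 0 T00.
have [sF0 mF0] := filtrationF.1 0 T00.
have HF0 : H 0 `<=` F 0 by exact: subHF.
have pHF phi : predictable T H phi -> predictable T F phi := predictable_sub T0 subHF (phi := phi).
have s0 : is_stochastic_integral P T F M QV (fun _ _ => 0 : R) (cst 0).
  exact: is_stochastic_integral0.
(* With zero integrand, H_0-events enter the space; orthogonality of the residual to them yields
   both conditional expectations given H_0. *)
have V_indic B : H 0 B -> V (\1_B).
  move=> HB; have BL : (\1_B : Omega -> R) \in Lfun P 2%:E by apply: Lfun2_indic; exact: mH0.
  split=> //; exists (\1_B), (fun _ _ => 0 : R), (cst 0); split=> //.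
  - exact: (measurable_wrt_indic sH0).
  - split; first exact: (measurable_wrt_cst (sigma_algebra_predictable_sets T H)).
    rewrite /dMdP_sqnorm integral0_eq ?ltry// => w _.
    by rewrite integral0_eq// => t _; rewrite expr0n.
  - by apply: nearW => w; rewrite /= addr0.
have [v Vv orth] := Lfun2_projection VC xiL2.
have [vL [U [phi [I [mU aphi sI ev]]]]] := Vv.
have zL := Lfun2B xiL2 vL.
have zFT : measurable_wrt (F T) (fun w => xi w - v w).
  by rewrite F_T => B mB; rewrite -[X in measurable X]setTI; exact: (Lfun2_measurable zL).
have [N martO OT] := cadlag_martingale_version T_gt0 filtrationF usualF zL zFT.
have [[NF _ _] cO OL] := martO.
have [IL UL] := (sI.1, Lfun2_initial T0 filtrationH mU vL sI.1 ev).
have orthO eta : V eta -> ip P (N T) eta = 0.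
  move=> Veta; rewrite (ae_eq_ip (OL _ TT) zL _ OT); first exact: orth.
  exact: (cs_Lfun VC).
have decomp : {ae P, forall w, xi w = U w + I w + N T w}.
  by apply: filterS2 ev OT => w <- ->; rewrite addrC subrK.
have ae_refl (f : Omega -> R) : {ae P, forall w, f w = f w} by exact: nearW.
have UIV : V (fun w => U w + I w).
  split; first exact: Lfun2D.
  by exists U, phi, I; split => //; exact: nearW.
(* Stated for F_0 and not only for H_0, so that the identity below also serves the final
   equivalence. *)
have ipI B : F 0 B -> ip P \1_B I = 0.
  move=> FB; apply: (ip_stochastic_integral T0 filtrationF martM qvM (pHF _ aphi.1) sI).
    exact: (measurable_wrt_indic sF0).
  by apply: Lfun2_indic; exact: mF0.
have ip_dec B : F 0 B -> ip P \1_B (fun w => xi w - U w) = ip P \1_B (N T).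
  move=> FB; have BL : (\1_B : Omega -> R) \in Lfun P 2%:E by apply: Lfun2_indic; exact: mF0.
  have E : {ae P, forall w, xi w - U w = I w + N T w}.
    by apply: filterS decomp => w ->; ring.
  rewrite ipC (ae_eq_ip (Lfun2B xiL2 UL) (Lfun2D IL (OL _ TT)) BL E).
  by rewrite ipC (ipDr IL (OL _ TT) BL) ipI// add0r.
exists U, phi, N; split.
- split=> //; first by exists I.
  move=> eta Veta; rewrite unlock ipE; [|exact: OL|exact: (cs_Lfun VC)].
  by rewrite orthO.
- move=> U' phi' O' [mU' aphi' martO' [I' sI' decomp'] orthO'].
  have [[OF' _ _] cO' OL'] := martO'.
  have IL' := sI'.1.
  have UL' : U' \in Lfun P 2%:E.
    apply: (ae_eq_Lfun2 _ (Lfun2B (Lfun2B xiL2 IL') (OL' _ TT))).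
      exact: measurable_wrt_measurable mU'.
    by apply: filterS decomp' => w ->; ring.
  have UIV' : V (fun w => U' w + I' w).
    split; first exact: Lfun2D.
    by exists U', phi', I'; split => //; exact: nearW.
  (* The difference of the two projections is in V and equals O'_T - N_T a.s.; both residuals being
     orthogonal to V, z is orthogonal to itself. *)
  pose z w := - 1 * (U' w + I' w) + (U w + I w).
  have Vz : V z by exact: Vlin.
  have zL' := cs_Lfun VC Vz.
  have Oz : {ae P, forall w, O' T w - N T w = z w}.
    apply: filterS2 decomp decomp' => w e e'; rewrite /z.
    have : U w + I w + N T w = U' w + I' w + O' T w by rewrite -e.
    by move=> h; lra.
  have orth' : ip P (O' T) z = 0.
    have := orthO' _ Vz; rewrite unlock ipE; [|exact: OL'|by []].
    by case.
  have z0 : ip P z z = 0.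
    rewrite -(ae_eq_ip (Lfun2B (OL' _ TT) (OL _ TT)) zL' zL' Oz).
    by rewrite (ipBl (OL' _ TT) (OL _ TT) zL') orth' orthO// subrr.
  (* Pythagoras writes the null squared norm of z as the sum of the squared distances of the initial
     variables and of the integrands, so both vanish. *)
  have := ip_dist_integral_space T0 filtrationF filtrationH subHF martM qvM
    mU mU' (cs_Lfun VC UIV) (cs_Lfun VC UIV') (pHF _ aphi.1) (pHF _ aphi'.1) sI sI'
    (ae_refl _) (ae_refl _).
  rewrite (_ : ip P _ _ = 0); last first.
    by rewrite -z0; apply: eq_ip => w; rewrite /z; ring.
  move=> /esym/eqP; rewrite paddr_eq0 ?ip_ge0// => /andP[/eqP U0 /eqP phi0].
  split.
  + have := ip_sq_ae0 (Lfun2B UL UL') U0; apply: filterS => w /eqP.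
    by rewrite subr_eq0 => /eqP.
  + apply: (dMdP_ae_eqP (pHF _ aphi.1) (pHF _ aphi'.1) _ _ phi0).
      by have [] := iffLR (admissible_integrandP T0 filtrationF subHF martM qvM phi) aphi.
    by have [] := iffLR (admissible_integrandP T0 filtrationF subHF martM qvM phi') aphi'.
  + apply: (ae_eq_indistinguishable T_gt0 cO' cO).
    apply: (martingale_ae_eq filtrationF martO' martO).
    have := ip_sq_ae0 zL' z0.
    by apply: filterS2 Oz => w <- /eqP; rewrite subr_eq0 => /eqP.
- apply: (iffLR (is_cond_expP mH0 xiL2 UL mU)) => B HB.
  by rewrite ip_dec; [rewrite ipC orthO//; exact: V_indic|exact: HF0].
- have c0 : (cst 0 : Omega -> R) \in Lfun P 2%:E by exact: (cs_Lfun VC V0).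
  apply: (iffLR (is_cond_expP mH0 (OL _ TT) c0 (measurable_wrt_cst sH0 0))) => B HB.
  rewrite -[RHS](orthO (\1_B)); last exact: V_indic.
  by rewrite ipC; apply: eq_ip => // w; rewrite subr0.
- have UF0 : measurable_wrt (F 0) U by exact: measurable_wrtS mU.
  (* Together with [ip_dec], this says that [N 0] and [xi - U] have the same integral over every
     F_0-event. *)
  have ipO B : F 0 B -> ip P \1_B (N T) = ip P \1_B (N 0).
    move=> FB; have BL : (\1_B : Omega -> R) \in Lfun P 2%:E by apply: Lfun2_indic; exact: mF0.
    apply/eqP; rewrite -subr_eq0 -(ipBr (OL _ TT) (OL _ T00) BL).
    rewrite (ip_martingale_increment filtrationF martO)//.
    exact: (measurable_wrt_indic sF0).
  split=> [Z0|/(iffRL (is_cond_expP mF0 xiL2 UL UF0)) h].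
    apply: (iffLR (is_cond_expP mF0 xiL2 UL UF0)) => B FB.
    have BL : (\1_B : Omega -> R) \in Lfun P 2%:E by apply: Lfun2_indic; exact: mF0.
    have c0 : (cst 0 : Omega -> R) \in Lfun P 2%:E by exact: (cs_Lfun VC V0).
    rewrite ip_dec// ipO// ipC (ae_eq_ip (OL _ T00) c0 BL Z0).
    by rewrite /ip /Rintegral integral0_eq// => w _; rewrite mul0r.
  (* [N 0] integrates to 0 over every F_0-event and is itself F_0-measurable, hence orthogonal to
     itself. *)
  have O00 : ip P (N 0) (N 0) = 0.
    apply: (Lfun2_orthogonal sF0 mF0 (OL _ T00) (OL _ T00) _ (NF _ T00)) => B FB.
    by rewrite (integral_ip_indic (mF0 _ FB) (OL _ T00)) -ipO// -ip_dec// h.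
  exact: (ip_sq_ae0 (OL _ T00) O00).
Qed.
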